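(* Every tournament $H$ on six vertices that is not isomorphic to $H_D$ satisfies the Erdős–Hajnal Conjecture: there exists $\epsilon(H)>0$ such that every tournament $T$ not containing $H$ as a subtournament contains a transitive subtournament on at least $|T|^{\epsilon(H)}$ vertices.
   Context: Tournaments are finite; subtournament = induced subtournament; transitive = no directed cycle. Given an ordering of the vertices, an edge $(x,y)$ is backward if $y$ precedes $x$; a tournament on an ordered vertex set is determined by its backward edges. $H_D$ is the tournament with vertex set $\{1,\dots,6\}$ whose backward edges under the ordering $(1,2,3,4,5,6)$ are exactly $(4,1),(6,3),(5,2),(6,1)$. *)

(* Defs.v *)
From HB Require Import structures.
From mathcomp Require Import all_boot all_order all_algebra.
From mathcomp Require Import reals exp.

Set Implicit Arguments.
Unset Strict Implicit.
Unset Printing Implicit Defensive.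

Import Order.TTheory GRing.Theory Num.Theory.

Record tournament := Tournament {
  vertex :> finType;
  arc : rel vertex;
  arc_irr : irreflexive arc;
  arc_total : forall x y : vertex, x != y -> arc x y (+) arc y x
}.

Definition isomorphic (G H : tournament) : Prop :=
  exists2 f : G -> H, bijective f & {mono f : x y / arc x y}.

Section Induced.
Variables (T : tournament) (S : {set T}).

Definition induced_arc : rel {x : T | x \in S} :=
  fun u v => arc (val u) (val v).

Lemma induced_irr : irreflexive induced_arc.
Proof. by move=> u; apply: arc_irr. Qed.

Lemma induced_total (u v : {x : T | x \in S}) :
  u != v -> induced_arc u v (+) induced_arc v u.
Proof. by move=> neq_uv; apply: arc_total. Qed.

Definition induced : tournament := Tournament induced_irr induced_total.

End Induced.

Definition contains (T H : tournament) : Prop :=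
  exists S : {set T}, isomorphic (induced S) H.

(* No directed cycle; [ucycle] also accepts the empty sequence. *)
Definition transitive_tournament (T : tournament) : Prop :=
  forall c : seq T, ucycle (@arc T) c -> c = [::].

(* For the empty tournament, [0 `^ eps] is [0] since [eps != 0]. *)
Definition erdos_hajnal (R : realType) (H : tournament) : Prop :=
  exists2 eps : R, (0 < eps)%R &
    forall T : tournament, ~ contains T H ->
      exists2 S : {set T}, transitive_tournament (induced S) &
        (#|T|%:R `^ eps <= #|S|%:R :> R)%R.

Section BackwardArcs.
Variables (n : nat) (B : seq (nat * nat)).

(* The tournament on [1, ..., n], the vertex [i : 'I_n] being labelled [i.+1],
   whose backward arcs are the pairs (larger label, smaller label) in [B]. *)
Definition backward_arc : rel 'I_n := fun i j =>
  if i < j then (j.+1, i.+1) \notin B else (j < i) && ((i.+1, j.+1) \in B).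

Lemma backward_irr : irreflexive backward_arc.
Proof. by move=> i; rewrite /backward_arc ltnn. Qed.

Lemma backward_total (i j : 'I_n) :
  i != j -> backward_arc i j (+) backward_arc j i.
Proof.
by rewrite -val_eqE /backward_arc /=; case: ltngtP => // _ _; case: (_ \in B).
Qed.

Definition backward_tournament : tournament :=
  Tournament backward_irr backward_total.

End BackwardArcs.

Definition H_D : tournament :=
  backward_tournament 6 [:: (4, 1); (6, 3); (5, 2); (6, 1)].

(* Main.v *)
Require Import Defs.
From mathcomp Require Import all_boot all_order all_algebra.
From mathcomp Require Import reals exp.
From mathcomp Require Import zify.
(* Again, so that [arc] does not denote [path.arc]. *)
Require Import Defs.

(* Suppose that [T] omits [H] and that every subset of positive density of [T] has
   a transitive subset almost as large as the largest one of [T] (otherwise induct).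
   Then [T] contains consecutive large sets with very few backward arcs, one of
   which can be replaced by segments of a large transitive set, and two large parts
   of these sets are always joined by a backward arc, since otherwise transitive
   subsets could be concatenated. So disjoint stars of backward arcs can be found
   one after the other, provided that the centres are not in the transitive set:
   this settles the galaxies.
   A tournament with a module reduces to smaller ones by the substitution argument
   of Alon, Pach and Solymosi. Up to reversal, the prime tournaments on at most six
   vertices other than [H_D] embed into galaxies or into two further tournaments.
   For these, choose [b -> a] with [a] in the first set and [b] in the last one,
   both having backward neighbours in all segments. If no such neighbour is common
   to [a] and [b], one of their orderings can be found, with a path of backward arcs
   through [a] and [b]; a common neighbour gives a backward triangle, which occurs in
   another ordering of the same tournament. *)

Set Implicit Arguments.
Unset Strict Implicit.
Unset Printing Implicit Defensive.

(** * Largest transitive subsets *)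

Section Chains.
Variable T : tournament.
Implicit Types (X Y Z : {set T}) (s : seq T).

Lemma arcC (x y : T) : x != y -> arc y x = ~~ arc x y.
Proof. by move/arc_total; case: arc; case: arc. Qed.

Lemma arc_neq (x y : T) : arc x y -> x != y.
Proof. by apply: contraTneq => ->; rewrite arc_irr. Qed.

Lemma arc_asym (x y : T) : arc x y -> arc y x = false.
Proof. by move=> xy; rewrite (arcC (arc_neq xy)) xy. Qed.

Definition chain X s := pairwise (@arc T) s && all [in X] s.

Lemma chain_uniq X s : chain X s -> uniq s.
Proof.
case/andP=> + _; elim: s => //= x s IHs /andP[xs /IHs ->]; rewrite andbT.
by apply/negP => /(allP xs); rewrite arc_irr.
Qed.

Lemma chain_size X s : chain X s -> size s <= #|X|.
Proof.
move=> cs; rewrite -(card_uniqP (chain_uniq cs)).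
by case/andP: cs => _ /allP sX; apply/subset_leq_card/subsetP.
Qed.

Definition tr X : nat :=
  \max_(i < #|T|.+1 | [exists s : i.-tuple T, chain X s]) i.

Lemma tr_ge X s : chain X s -> size s <= tr X.
Proof.
move=> cs; have ltT : size s < #|T|.+1.
  by rewrite ltnS (leq_trans (chain_size cs)) ?max_card.
by apply: (@leq_bigmax_cond _ _ _ (Ordinal ltT));
  apply/existsP; exists (in_tuple s).
Qed.

Lemma tr_chain X : exists2 s, chain X s & size s = tr X.
Proof.
have [|i /existsP[s cs] /esym tri] :=
    @eq_bigmax_cond _ [pred i : 'I_#|T|.+1 | [exists s : i.-tuple T, chain X s]]
    (@nat_of_ord _).
  by apply/card_gt0P; exists ord0; apply/existsP; exists [tuple].
by exists s; rewrite ?size_tuple.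
Qed.

Lemma chainS X Y s : X \subset Y -> chain X s -> chain Y s.
Proof.
by move=> /subsetP XY /andP[cs /allP sX]; rewrite /chain cs; apply/allP => x /sX /XY.
Qed.

Lemma trS X Y : X \subset Y -> tr X <= tr Y.
Proof. by move=> XY; have [s cs <-] := tr_chain X; apply/tr_ge/(chainS XY). Qed.

Lemma tr_le_card X : tr X <= #|X|.
Proof. by have [s cs <-] := tr_chain X; apply: chain_size. Qed.

Lemma tr_gt0 X : (0 < tr X) = (0 < #|X|).
Proof.
apply/idP/idP => [/leq_trans->//|]; first exact: tr_le_card.
by case/card_gt0P=> x xX; apply: (@tr_ge X [:: x]); rewrite /chain /= xX.
Qed.

Lemma tr_gt1 X : 1 < #|X| -> 1 < tr X.
Proof.
case/card_gt1P=> x [y [xX yX nxy]].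
have [xy|] := boolP (arc x y).
  by apply: (@tr_ge X [:: x; y]); rewrite /chain /= xy xX yX.
by rewrite -(arcC nxy) => yx; apply: (@tr_ge X [:: y; x]); rewrite /chain /= yx xX yX.
Qed.

Lemma trU X Y Z : X \subset Z -> Y \subset Z ->
  (forall x y, x \in X -> y \in Y -> arc x y) -> tr X + tr Y <= tr Z.
Proof.
move=> XZ YZ XY; have [s cs <-] := tr_chain X; have [r cr <-] := tr_chain Y.
rewrite -size_cat; apply: tr_ge; rewrite /chain all_cat pairwise_cat.
have /andP[-> ->] := chainS XZ cs; have /andP[-> ->] := chainS YZ cr.
rewrite !andbT; apply/allrelP => x y xs yr.
by case/andP: cs cr => _ /allP/(_ x xs) xX /andP[_ /allP/(_ y yr)]; apply: XY.
Qed.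

(** One of the out- and in-neighbourhoods of a vertex [x] of [X] contains [2 ^ d] vertices when [X]
    has [2 ^ d.+1], and [x] can be put before, respectively after, a chain in it. *)
Lemma tr_log d X : 2 ^ d <= #|X| -> d <= tr X.
Proof.
elim: d X => // d IHd X leX.
have /card_gt0P[x xX] : 0 < #|X| by rewrite (leq_trans _ leX) ?expn_gt0.
pose Xo := [set y in X | arc x y]; pose Xi := [set y in X | arc y x].
have XE : #|X| <= 1 + (#|Xo| + #|Xi|).
  rewrite -(cards1 x) (leq_trans _ (leq_add (leqnn _) (leq_card_setU _ _))) //.
  apply: leq_trans (leq_card_setU _ _); apply/subset_leq_card/subsetP => y yX.
  rewrite !inE yX /=; have [//|nyx] := eqVneq y x.
  by rewrite (arcC nyx) orNb.
have [leo|lto] := leqP (2 ^ d) #|Xo|.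
  apply: leq_ltn_trans (IHd _ leo) _.
  apply: leq_trans (_ : tr [set x] + tr Xo <= _).
    by rewrite -[_.+1]add1n leq_add2r tr_gt0 cards1.
  apply: trU; rewrite ?sub1set //.
    by apply/subsetP => y; rewrite inE => /andP[].
  by move=> _ y /set1P-> ; rewrite inE => /andP[].
have lei : 2 ^ d <= #|Xi| by rewrite expnS in leX; lia.
apply: leq_ltn_trans (IHd _ lei) _.
apply: leq_trans (_ : tr Xi + tr [set x] <= _).
  by rewrite -addn1 leq_add2l tr_gt0 cards1.
apply: trU; rewrite ?sub1set //.
  by apply/subsetP => y; rewrite inE => /andP[].
by move=> y _ + /set1P->; rewrite inE => /andP[].
Qed.

Lemma sub_card (m : nat) X : m <= #|X| -> exists2 Y : {set T}, Y \subset X & #|Y| = m.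
Proof.
case/card_geqP=> s [us <- sX]; exists [set x in s].
  by apply/subsetP => x; rewrite inE => /sX.
by rewrite cardsE; apply/card_uniqP.
Qed.

End Chains.

(** * Embeddings, the polynomial bound and reversal *)

(** Preserving arcs forces injectivity on [U], as two distinct vertices are always joined by an
    arc. *)
Definition embeds (H T : tournament) (U : {set H}) (Z : {set T}) :=
  exists2 f : H -> T, {in U &, {mono f : x y / arc x y}} & {in U, forall x, f x \in Z}.

(** The Erdős-Hajnal property in integer form, with [a] in the role of [1 / eps]. Subsets [U] and
    [Z] replace whole tournaments so that both can be shrunk by induction. *)
Definition EH (H : tournament) (U : {set H}) :=
  exists a, forall (T : tournament) (Z : {set T}), ~ embeds U Z -> #|Z| <= tr Z ^ a.

Lemma embeds_trans (H T S : tournament) (U : {set H}) (Z : {set T}) (Y : {set S}) :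
  embeds U Z -> embeds Z Y -> embeds U Y.
Proof.
move=> [f fm fZ] [g gm gY]; exists (g \o f) => [x y xU yU|x xU] /=.
  by rewrite gm ?fZ ?fm.
by rewrite gY ?fZ.
Qed.

Lemma EH_embeds (H T : tournament) (U : {set H}) (Z : {set T}) :
  embeds U Z -> EH Z -> EH U.
Proof.
move=> UZ [a Ea]; exists a => S Y nUY; apply: Ea => ZY; apply: nUY.
exact: embeds_trans ZY.
Qed.

Lemma embeds_sub (H T : tournament) (U : {set H}) (Z Y : {set T}) :
  Z \subset Y -> embeds U Z -> embeds U Y.
Proof. by move=> /subsetP ZY [f fm fZ]; exists f => // x /fZ/ZY. Qed.

Lemma pairwise_rev (X : Type) (r : rel X) (s : seq X) :
  pairwise r (rev s) = pairwise (fun x y => r y x) s.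
Proof. by elim: s => //= x s <-; rewrite rev_cons pairwise_rcons all_rev. Qed.

Section Reversal.
Variable T : tournament.

Definition rev_arc : rel T := fun x y => arc y x.

Lemma rev_irr : irreflexive rev_arc.
Proof. exact: arc_irr. Qed.

Lemma rev_total (x y : T) : x != y -> rev_arc x y (+) rev_arc y x.
Proof. by rewrite eq_sym => /arc_total. Qed.

Definition rev_tournament := Tournament rev_irr rev_total.

Lemma tr_rev (X : {set T}) : @tr rev_tournament X = tr X.
Proof.
apply/eqP; rewrite eqn_leq; apply/andP; split.
  have [s /andP[cs aX] <-] := @tr_chain rev_tournament X.
  by rewrite -size_rev; apply: tr_ge; rewrite /chain all_rev pairwise_rev aX andbT.
have [s /andP[cs aX] <-] := tr_chain X.
rewrite -size_rev; apply: (@tr_ge rev_tournament).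
by rewrite /chain all_rev aX andbT pairwise_rev.
Qed.

End Reversal.

Lemma EH_rev (H : tournament) (U : {set H}) : EH U -> @EH (rev_tournament H) U.
Proof.
move=> [a Ea]; exists a => T Z nUZ; rewrite -(tr_rev (Z : {set T})).
apply: (Ea (rev_tournament T)) => -[f fm fZ]; apply: nUZ; exists f => // x y xU yU.
exact: fm.
Qed.

Lemma mul_pred_exp_le K b : 1 < K -> K * K <= b -> K * K.-1 ^ b <= K ^ b.
Proof.
case: K => [//|[//|k]] _ leKb /=; set L := k.+1.
(* The claim is [(1 - 1/K) ^ b <= 1/K]; it follows from Bernoulli's inequality
   [(1 + 1/L) ^ c >= 1 + c/L], where [L] is [K - 1]. *)
have bern c : L ^ c * (L + c) <= L.+1 ^ c * L.
  elim: c => [|c IHc]; first by rewrite !expn0 addn0.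
  rewrite !expnS; have := leq_mul (leqnn L.+1) IHc; nia.
have L0 : 0 < L by [].
rewrite -(leq_pmul2r L0); apply: leq_trans (bern b).
rewrite mulnAC mulnC leq_mul2l; apply/orP; right; rewrite /L in leKb *; nia.
Qed.

(** When passing to [X] costs at most a factor [K] in size and lowers [tr] by the factor [1 - 1/K],
    the bound with exponent [b = K * K] passes from [X] to [Z], because [(1 - 1/K) ^ b <= 1/K]. *)
Lemma EH_core (H : tournament) (U : {set H}) K : 1 < K ->
  (forall (T : tournament) (Z : {set T}), ~ embeds U Z -> K <= #|Z| ->
     exists2 X : {set T}, X \subset Z &
       (#|Z| <= K * #|X|) && (K * tr X < K.-1 * tr Z)) -> EH U.
Proof.
move=> K1 core; exists (K * K) => T Z; have [n] := ubnP #|Z|.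
elim: n Z => // n IHn Z ltZn nUZ.
(* Small sets: two vertices already give [tr Z >= 2], and [2 ^ (K * K) > K]. *)
have [|leKZ] := ltnP #|Z| K => [ltZK|].
  have [Z1|] := leqP #|Z| 1 => [|/tr_gt1 tr1].
    have [-> //|Z0] := posnP #|Z|; apply: leq_trans Z1 _.
    by rewrite expn_gt0 tr_gt0 Z0.
  apply: leq_trans (ltnW ltZK) _.
  have := ltn_expl (K * K) (isT : 1 < 2); have := leq_pmulr K (ltnW K1).
  move=> /leq_ltn_trans h /h /ltnW /leq_trans; apply.
  by rewrite leq_exp2r // muln_gt0 (ltnW K1).
have [X XZ /andP[ZX trX]] := core T Z nUZ leKZ.
have pXZ : X \proper Z.
  rewrite properEneq XZ andbT; apply: contraTneq trX => ->.
  by rewrite -leqNgt leq_mul2r leq_pred orbT.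
have IHX : #|X| <= tr X ^ (K * K).
  apply: IHn; first by apply: leq_trans (proper_card pXZ) _; lia.
  by move=> /(embeds_sub XZ).
have Kb0 : 0 < K ^ (K * K) by rewrite expn_gt0 (ltnW K1).
rewrite -(leq_pmul2l Kb0).
apply: leq_trans (_ : K * (K * tr X) ^ (K * K) <= _).
  rewrite expnMn mulnCA leq_pmul2l //; apply: leq_trans ZX _.
  by rewrite leq_pmul2l ?(ltnW K1).
apply: leq_trans (_ : K * (K.-1 * tr Z) ^ (K * K) <= _).
  by rewrite leq_pmul2l ?(ltnW K1) // leq_exp2r ?(ltnW trX) // muln_gt0 (ltnW K1).
by rewrite expnMn mulnA leq_mul2r mul_pred_exp_le ?orbT.
Qed.

(** * Counting functions by changing one value *)

Section Update.
Variables I S : finType.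

Definition update (g : {ffun I -> S}) i x : {ffun I -> S} :=
  [ffun j => if j == i then x else g j].

Lemma updateE g i x j : update g i x j = if j == i then x else g j.
Proof. by rewrite ffunE. Qed.

(* Double counting of the pairs [(g, x)] with [P (update g i x)]:
   [(g, x) |-> (update g i x, g i)] is an involution. *)
Lemma update_count i (P : pred {ffun I -> S}) w :
    (forall g, #|[set x | P (update g i x)]| <= w) ->
  #|S| * #|[set g | P g]| <= w * #|S| ^ #|I|.
Proof.
move=> leP; pose f (u : {ffun I -> S} * S) := (update u.1 i u.2, u.1 i).
have fK : involutive f.
  move=> [g x]; rewrite /f /= !updateE eqxx; congr (_, _); apply/ffunP => j.
  by rewrite !updateE; case: eqP => [->|].
rewrite mulnC -cardsT -cardsX -(card_imset _ (can_inj fK)).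
rewrite (@leq_trans (\sum_(g : {ffun I -> S}) #|[set x | P (update g i x)]|)) //.
  rewrite (eq_bigr _ (fun g _ => esym (sum1_card _))) pair_big_dep /= sum1_card.
  apply/subset_leq_card/subsetP => _ /imsetP[[g x] + ->].
  rewrite !inE /= => /andP[Pg _]; rewrite unfold_in /= /f /=.
  change (g i \in [set y | P (update (update g i x) i y)]); rewrite inE.
  by have /(congr1 fst) /= -> := fK (g, x).
apply: leq_trans (_ : \sum_(g : {ffun I -> S}) w <= _); first exact: leq_sum.
by rewrite sum_nat_const card_ffun mulnC cardsT.
Qed.

End Update.

Lemma card_exists_le (I S : finType) (P : I -> pred S) n c :
    (forall i, n * #|[set x | P i x]| <= c) ->
  n * #|[set x | [exists i, P i x]]| <= #|I| * c.
Proof.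
move=> leP; have -> : [set x | [exists i, P i x]] = \bigcup_i [set x | P i x].
  apply/setP => x; rewrite inE; apply/existsP/bigcupP => [[i Pi]|[i _]].
    by exists i => //; rewrite inE.
  by rewrite inE => Pi; exists i.
apply: leq_trans (_ : n * (\sum_i #|[set x | P i x]|) <= _).
  rewrite leq_mul2l; apply/orP; right.
  elim/big_rec2: _ => [|i m A _ leA]; first by rewrite cards0.
  by apply: leq_trans (leq_card_setU _ _) _; rewrite leq_add2l.
by rewrite big_distrr /= -sum_nat_const; apply: leq_sum.
Qed.

Lemma leq_expl m n e : m <= n -> m ^ e <= n ^ e.
Proof. by case: e => // e mn; rewrite leq_exp2r. Qed.

(** * Substitution: tournaments with a module *)

Section Substitution.
Variables (H : tournament) (U W : {set H}) (v : H).
Hypothesis vW : v \in W.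
Hypothesis Whom : {in U :\: W & W, forall x w, arc x w = arc x v}.

(** The quotient, in which the module [W] is contracted to [v]. *)
Let U1 := v |: (U :\: W).

Lemma Whom' : {in U :\: W & W, forall x w, arc w x = arc v x}.
Proof.
move=> x w xUW wW; have neq u : u \in W -> x != u.
  by move=> uW; apply: contraTneq xUW => ->; rewrite inE uW.
by rewrite !(@arcC _ x) ?neq // (Whom xUW wW).
Qed.

(** Choose [m = tr Z ^ a1 + 1] points of [Z] at random. Once all points but the one playing [v] are
    fixed, the choices for that point that complete a given copy of [U1] contain no copy of [W],
    which could replace [v] and give [U]; so there are at most [tr Z ^ a2] of them. If every choice
    has a repetition or a copy of [U1], then [#|Z|] is polynomially bounded in [tr Z]; otherwise
    some [m] points violate the bound for [U1]. *)
Lemma EH_subst : EH W -> EH U1 -> EH U.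
Proof.
move=> [a2 E2] [a1 E1]; pose k := #|H|.
(* This exponent bounds [m * m + m ^ k * t ^ a2], where [m <= t ^ a1.+1]; the last successor absorbs
   the factor 2 from the two summands. *)
exists ((a1.+1) * k.+2 + a2).+1 => T Z nUZ.
have [Z1|/tr_gt1 t1] := leqP #|Z| 1.
  by have [-> //|Z0] := posnP #|Z|; rewrite (leq_trans Z1) // expn_gt0 tr_gt0 Z0.
set t := tr Z in t1 *; pose m := (t ^ a1).+1; pose S : finType := {x : T | x \in Z}.
have cardS : #|{: S}| = #|Z| by rewrite card_sig; apply: eq_card => x.
pose Inj (p : 'I_m * 'I_m) (g : {ffun 'I_m -> S}) := (p.1 != p.2) && (g p.1 == g p.2).
pose Emb (h : {ffun H -> 'I_m}) (g : {ffun 'I_m -> S}) :=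
  [forall x in U1, forall y in U1, arc (val (g (h x))) (val (g (h y))) == arc x y].
have EmbP (h : {ffun H -> 'I_m}) (g : {ffun 'I_m -> S}) :
      reflect {in U1 &, forall x y, arc (val (g (h x))) (val (g (h y))) = arc x y} (Emb h g).
  apply: (iffP forall_inP) => [E x y xU yU|E x xU].
    by apply/eqP; move/forall_inP: (E x xU); apply.
  by apply/forall_inP => y yU; rewrite E.
have vU1 : v \in U1 by rewrite !inE eqxx.
have leInj p : #|S| * #|[set g | Inj p g]| <= 1 * #|S| ^ #|'I_m|.
  apply: (update_count (i := p.1)) => g.
  have [nep|eqp] := eqVneq p.2 p.1.
    rewrite (_ : [set _ | _] = set0) ?cards0 //.
    by apply/setP => x; rewrite !inE /Inj nep eqxx.
  rewrite -(cards1 (g p.2)); apply/subset_leq_card/subsetP => x.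
  by rewrite !inE /Inj !updateE eqxx (negPf eqp) => /andP[].
have leEmb h : #|S| * #|[set g | Emb h g]| <= t ^ a2 * #|S| ^ #|'I_m|.
  apply: (update_count (i := h v)) => g.
  (* If [h] sent [y] and [v] to the same index, their images would coincide and have no arc between
     them, so [X] would be empty. *)
  rewrite leqNgt; apply/negP; set X := [set x | _] => ltX.
  have hv y : y \in U1 -> y != v -> h y != h v.
    move=> yU nyv; apply: contraTneq ltX => hyv; rewrite -leqNgt.
    rewrite (_ : X = set0) ?cards0 //; apply/setP => x; rewrite !inE; apply/negP.
    move/EmbP => E; move: (E v y vU1 yU) (E y v yU vU1); rewrite hyv arc_irr => vy yv.
    by move: (arc_total nyv); rewrite -vy -yv.
  have XE x y : x \in X -> y \in U :\: W ->
     arc (val x) (val (g (h y))) = arc v y /\ arc (val (g (h y))) (val x) = arc y v.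
    rewrite inE => /EmbP E yUW; have nyv : y != v.
      by apply: contraTneq yUW => ->; rewrite inE vW.
    have yU1 : y \in U1 by rewrite 2!inE yUW orbT.
    by have := E v y vU1 yU1; have := E y v yU1 vU1; rewrite !updateE eqxx (negPf (hv y yU1 nyv)).
  have ltVX : t ^ a2 < #|[set val x | x in X]| by rewrite card_imset //; apply: val_inj.
  suff nW : ~ embeds W [set val x | x in X].
    move: ltVX; rewrite ltnNge (leq_trans (E2 _ _ nW)) //.
    by apply/leq_expl/trS/subsetP => _ /imsetP[x _ ->]; apply: valP.
  (* The copy of [W] inside [X] takes the place of [v]; the other vertices stay where [h] and [g]
     put them. *)
  case=> f2 f2m f2X; apply: nUZ.
  exists (fun y => if y \in W then f2 y else val (g (h y))); last first.
    by move=> y yU; case: ifP => [/f2X/imsetP[x _ ->]|_]; apply: valP.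
  move=> y z yU zU /=; case: ifP => [yW|/negbT nyW]; case: ifP => [zW|/negbT nzW].
  - exact: f2m.
  - have zUW : z \in U :\: W by rewrite inE nzW.
    by have /imsetP[x /XE/(_ zUW)[E _] ->] := f2X y yW; rewrite E Whom'.
  - have yUW : y \in U :\: W by rewrite inE nyW.
    by have /imsetP[x /XE/(_ yUW)[_ E] ->] := f2X z zW; rewrite E Whom.
  have /card_gt0P[x] : 0 < #|X| by apply: leq_trans ltX.
  have UU1 u : u \in U -> u \notin W -> u \in U1 /\ u != v.
    move=> uU nuW; rewrite !inE uU nuW orbT; split=> //.
    by apply: contraNneq nuW => ->.
  have [[yU1 nyv] [zU1 nzv]] := (UU1 y yU nyW, UU1 z zU nzW).
  rewrite inE => /EmbP/(_ y z yU1 zU1).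
  by rewrite !updateE (negPf (hv y yU1 nyv)) (negPf (hv z zU1 nzv)).
have [/forallP allbad|/forallPn[g]] :=
    boolP [forall g, [exists p, Inj p g] || [exists h, Emb h g]].
  have leZ : #|Z| <= #|{: 'I_m * 'I_m}| + #|{: {ffun H -> 'I_m}}| * t ^ a2.
    have Z0 : 0 < #|Z| by rewrite -tr_gt0 -/t ltnW.
    rewrite -(leq_pmul2r (_ : 0 < #|S| ^ #|'I_m|)) ?expn_gt0 ?cardS ?Z0 //.
    have cT : #|S| ^ #|'I_m| =
        #|[set g | [exists p, Inj p g]] :|: [set g | [exists h, Emb h g]]|.
      rewrite -card_ffun -cardsT; congr #|pred_of_set _|; apply/setP => g.
      by rewrite !inE allbad.
    rewrite mulnDl -mulnA -cardS {1}cT.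
    apply: leq_trans (leq_mul (leqnn _) (leq_card_setU _ _)) _; rewrite mulnDr.
    apply: leq_add; last exact: card_exists_le.
    by rewrite -(mul1n (_ ^ #|'I_m|)); apply: card_exists_le.
  have lem : m <= t ^ a1.+1.
    by rewrite /m expnS -[_.+1]addn1; have : 0 < t ^ a1 by [rewrite expn_gt0 ltnW]; nia.
  apply: leq_trans leZ _; rewrite card_prod card_ffun card_ord -/k expnS.
  apply: leq_trans (leq_mul t1 (leqnn _)); rewrite mul2n -addnn.
  have lepow c d : c <= d -> t ^ c <= t ^ d by apply: leq_pexp2l; apply: ltnW.
  apply: leq_add.
    apply: leq_trans (leq_mul lem lem) _; rewrite -expnD; apply: lepow; nia.
  apply: leq_trans (leq_mul (leq_expl k lem) (leqnn _)) _.
  rewrite -expnM -expnD; apply: lepow; nia.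
rewrite negb_or => /andP[/existsPn nInj /existsPn nEmb].
have gI : injective g.
  move=> i j gij; apply/eqP; apply: contraT => nij.
  by have := nInj (i, j); rewrite /Inj /= nij gij eqxx.
pose X := [set val (g i) | i : 'I_m].
have cardX : #|X| = m by rewrite card_imset ?card_ord //; apply: inj_comp gI; apply: val_inj.
have XZ : X \subset Z by apply/subsetP => _ /imsetP[i _ ->]; apply: valP.
(* [X] is too large for the bound of [U1]; a copy of [U1] in [X] would have positions in [g] that
   form a forbidden [h]. *)
suff: #|X| <= tr X ^ a1.
  by move/leq_trans/(_ (leq_expl a1 (trS XZ))); rewrite cardX ltnn.
apply: E1 => -[f fm fX].
pose h : {ffun H -> 'I_m} := [ffun y => odflt ord0 [pick i | val (g i) == f y]].
have hE y : y \in U1 -> val (g (h y)) = f y.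
  move/fX/imsetP => [i _ fy]; rewrite ffunE; case: pickP => [j /eqP //|/(_ i)].
  by rewrite fy eqxx.
by case/negP: (nEmb h); apply/EmbP => y z yU zU; rewrite !hE ?fm.
Qed.

End Substitution.

(** * Pairs and families of sets with few backward arcs *)

Section Sparse.
Variable T : tournament.
Implicit Types (X Y Z : {set T}) (e : rel T).

Definition few M e X Y := [forall x in X, M * #|[set y in Y | e x y]| <= #|Y|].

Lemma card_sum_pred (P : pred T) X : #|[set x in X | P x]| = \sum_(x in X) P x.
Proof.
rewrite -sum1_card (eq_bigl (fun x => (x \in X) && P x)).
  by rewrite big_mkcondr /=; apply: eq_bigr => x _; case: (P x).
by move=> x; rewrite inE.
Qed.

(** Markov's inequality: at most [#|X| * #|Y| / (r * M)] pairs are related by [e], and each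
    exceptional [y] accounts for more than [#|X| / M] of them. *)
Lemma few_swap r M e X Y : few (r * M) e X Y ->
  r * #|[set y in Y | #|X| < M * #|[set x in X | e x y]|]| <= #|Y|.
Proof.
move=> /forall_inP fXY; have [X0|X0] := posnP #|X|.
  rewrite (_ : [set _ in _ | _] = set0) ?cards0 ?muln0 //.
  apply/setP => y; rewrite !inE X0; have /eqP -> : #|[set x in X | e x y]| == 0.
    by rewrite -leqn0 -X0; apply/subset_leq_card/subsetP => x; rewrite inE => /andP[].
  by rewrite muln0 ltnn andbF.
set B := [set y in Y | _]; rewrite -(leq_pmul2l X0).
have leB : #|X| * #|B| <= M * \sum_(x in X) #|[set y in Y | e x y]|.
  apply: leq_trans (_ : \sum_(y in B) M * #|[set x in X | e x y]| <= _).
    rewrite mulnC -sum_nat_const; apply: leq_sum => y.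
    by rewrite inE => /andP[_ /ltnW].
  rewrite -big_distrr /= leq_mul2l; apply/orP; right.
  apply: leq_trans (_ : \sum_(y in Y) #|[set x in X | e x y]| <= _).
    rewrite [X in _ <= X](big_setID B) /= (setIidPr _) ?leq_addr //.
    by apply/subsetP => y; rewrite inE => /andP[].
  rewrite (eq_bigr _ (fun y _ => card_sum_pred (e^~ y) X)) exchange_big /=.
  by apply/eq_leq/eq_bigr => x _; rewrite (card_sum_pred (e x)).
rewrite mulnCA (leq_trans (leq_mul (leqnn r) leB)) // mulnA big_distrr /= -sum_nat_const.
exact: leq_sum.
Qed.

Lemma few_sub c M e X Y X' Y' : few (c * M) e X Y -> X' \subset X -> Y' \subset Y ->
  0 < c -> #|Y| <= c * #|Y'| -> few M e X' Y'.
Proof.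
move=> /forall_inP fXY /subsetP sX /subsetP sY c0 leY; apply/forall_inP => x /sX/fXY.
move=> /leq_trans/(_ leY); rewrite -mulnA leq_pmul2l //; apply: leq_trans.
rewrite leq_mul2l; apply/orP; right; apply/subset_leq_card/subsetP => y.
by rewrite !inE => /andP[/sY-> ->].
Qed.

Definition sparse M X Y :=
  [&& [disjoint X & Y], few M (fun x y => arc y x) X Y & few M (@arc T) Y X].

Lemma sparse_sub c M X Y X' Y' : sparse (c * M) X Y -> X' \subset X -> Y' \subset Y ->
  0 < c -> #|X| <= c * #|X'| -> #|Y| <= c * #|Y'| -> sparse M X' Y'.
Proof.
case/and3P=> dXY fXY fYX sX sY c0 cX cY; apply/and3P; split.
- exact: disjointWl sX (disjointWr sY dXY).
- exact: few_sub fXY _ _ _ _.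
- exact: few_sub fYX _ _ _ _.
Qed.

(** [X] and [Y] may overlap. A part [X'] of [X] with at most [#|Y| / 2] elements is removed from
    [Y], then the vertices with too many neighbours in [X']. Each removal leaves at least half,
    whence the factor 4. *)
Lemma few_sparse M e X Y : 0 < M -> 2 <= #|Y| -> few (4 * (2 * M)) e X Y ->
  exists X' Y' : {set T}, [/\ X' \subset X, Y' \subset Y, [disjoint X' & Y'],
    minn #|X| (#|Y| %/ 2) <= #|X'| & #|Y| <= 4 * #|Y'|] /\
    few M e X' Y' /\ few M (fun y x => e x y) Y' X'.
Proof.
move=> M0 Y2 fXY; have [X' sX cX'] := sub_card (geq_minl #|X| (#|Y| %/ 2)).
pose Y1 := Y :\: X'.
have leY1 : #|Y| <= 2 * #|Y1|.
  have := cardsID X' Y; have : #|Y :&: X'| <= #|X'| by apply/subset_leq_card/subsetIr.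
  rewrite cX' -/Y1; have := geq_minr #|X| (#|Y| %/ 2); have := leq_trunc_div #|Y| 2; lia.
have fXY1 : few (2 * (2 * M)) e X' Y1.
  apply: (@few_sub 2 (2 * (2 * M)) e X Y) => //; last by apply: subsetDl.
  by rewrite mulnA.
have := few_swap (_ : few (2 * M) e X' Y1); set B := [set y in Y1 | _] => leB.
have {}leB : 2 * #|B| <= #|Y1| by apply/leB/(few_sub fXY1); rewrite ?leq_pmull.
have cY' := cardsID B Y1; rewrite (setIidPr _) in cY'; last first.
  by apply/subsetP => y; rewrite inE => /andP[].
have leY' : #|Y1| <= 2 * #|Y1 :\: B| by lia.
exists X', (Y1 :\: B); split; last split.
- split=> //; last 2 first.
  + by rewrite cX'.
  + by lia.
  + exact: subset_trans (subsetDl _ _) (subsetDl _ _).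
  rewrite disjoint_sym disjoints_subset; apply/subsetP => y.
  by rewrite !inE => /and3P[_ ->].
- apply: (@few_sub 2 M e X' Y1) => //; last exact: subsetDl.
  by apply: (few_sub fXY1); rewrite ?leq_pmull.
apply/forall_inP => y /setDP[yY1]; rewrite inE yY1 /= -leqNgt; exact.
Qed.

End Sparse.

Lemma card_bigcup_le (I : eqType) (T : finType) (s : seq I) (F : I -> {set T}) :
  #|\bigcup_(i <- s) F i| <= \sum_(i <- s) #|F i|.
Proof.
elim/big_rec2: _ => [|i m A _ leA]; first by rewrite cards0.
by apply: leq_trans (leq_card_setU _ _) _; rewrite leq_add2l.
Qed.

Lemma sum_seq_le (I : eqType) (s : seq I) (F : I -> nat) c :
  {in s, forall i, F i <= c} -> \sum_(i <- s) F i <= size s * c.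
Proof.
elim: s => [|i s IHs] leF; first by rewrite big_nil.
rewrite big_cons mulSn leq_add ?leF ?mem_head // IHs // => j js.
by rewrite leF // inE js orbT.
Qed.

(** Vertices are embedded one at a time, [V h] being the candidates left for [h]. Either some vertex
    of [V h] keeps a fraction [1 / M] of the candidates of every later vertex, or [m] vertices of
    [V h] lose too many candidates of the same [g], and these two sets have few arcs in one
    direction. *)
Lemma greedy_embedding (H T : tournament) M m (z0 : T) (Z : {set T}) (hs : seq H)
    (V : H -> {set T}) :
    1 < M -> 0 < m -> uniq hs ->
    {in hs, forall h, V h \subset Z} -> {in hs, forall h, m * M ^ size hs <= #|V h|} ->
  (exists2 f : H -> T, {in hs &, {mono f : x y / arc x y}}
                     & {in hs, forall h, f h \in V h})
  \/ exists (e : rel T) (X Y : {set T}),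
      [/\ e =2 @arc T \/ e =2 (fun x y => arc y x), few M e X Y,
          (X \subset Z) && (Y \subset Z), m <= #|X| & m <= #|Y|].
Proof.
move=> M1 m0; elim: hs V => [|h hs IHhs] V; first by left; exists (fun=> z0).
rewrite cons_uniq => /andP[nhs uhs] VZ leV.
pose adj g v u := if arc h g then arc v u else @arc T u v.
pose bad g := [set v in V h | M * #|[set u in V g | adj g v u]| <= #|V g|].
have memh : h \in h :: hs by rewrite mem_head.
have memhs g : g \in hs -> g \in h :: hs by rewrite inE orbC => ->.
have leVm g : g \in h :: hs -> m <= #|V g|.
  by move/leV; apply: leq_trans; rewrite leq_pmulr // expn_gt0 (ltnW M1).
have [/hasP[g gs mbad]|/hasPn nbad] := boolP (has (fun g => m <= #|bad g|) hs).
  right; exists (adj g), (bad g), (V g); split=> //.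
  - by rewrite /adj; case: arc; [left|right].
  - by apply/forall_inP => v; rewrite inE => /andP[].
  - rewrite VZ ?memhs // andbT; apply: subset_trans (VZ h memh).
    by apply/subsetP => v; rewrite inE => /andP[].
  - by rewrite leVm ?memhs.
have [v vV vbad] : exists2 v, v \in V h & forall g, g \in hs -> v \notin bad g.
  have ltB : #|\bigcup_(g <- hs) bad g| < #|V h|.
    apply: leq_ltn_trans (card_bigcup_le _ _) _.
    apply: leq_ltn_trans (sum_seq_le (c := m) _) _.
      by move=> g /nbad; rewrite -ltnNge => /ltnW.
    apply: leq_trans (leV h memh); rewrite mulnC /= ltn_pmul2l //.
    by apply: ltnW; apply: ltn_expl.
  have [|v vV nvB] := subsetPn (_ : ~~ (V h \subset \bigcup_(g <- hs) bad g)).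
    by apply: contraL ltB => /subset_leq_card; rewrite -leqNgt.
  exists v => // g gs; apply: contra nvB => vg.
  by rewrite (big_rem g) //= inE vg.
pose V' g := [set u in V g | adj g v u].
have [|g gs|[f fm fV]|] := IHhs V' uhs.
- move=> g gs; apply: subset_trans (VZ g (memhs g gs)).
  by apply/subsetP => u; rewrite inE => /andP[].
- have := vbad g gs; rewrite inE vV /= -ltnNge => /ltnW.
  move/(leq_trans (leV g (memhs g gs))); rewrite /= expnS mulnCA leq_pmul2l //.
  exact: ltnW.
- left; exists (fun g => if g == h then v else f g) => [g g'|g].
    have fadj k : k \in hs -> arc v (f k) = arc h k /\ arc (f k) v = arc k h.
      move=> ks; have nkh : h != k by apply: contraNneq nhs => ->.
      have := fV k ks; rewrite inE /adj (arcC nkh) => /andP[_].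
      by case: ifP => _ a; rewrite (arc_asym a) a.
    rewrite !inE; have [-> _|_ /= gs] := eqVneq g h; have [-> _|_ /= gs'] := eqVneq g' h.
    + by rewrite !arc_irr.
    + by case: (fadj g' gs').
    + by case: (fadj g gs).
    + exact: fm.
  rewrite inE; have [-> _|_ /= gs] := eqVneq g h; first by [].
  by have := fV g gs; rewrite inE => /andP[].
by right.
Qed.

(** Without a copy of [U], the greedy embedding stops at a pair with few arcs in one direction; this
    direction decides which set comes first. *)
Lemma pair_sparse (H : tournament) (U : {set H}) M : 0 < M -> exists2 c, 0 < c &
  forall (T : tournament) (Z : {set T}), ~ embeds U Z -> c <= #|Z| ->
  exists X Y : {set T}, [/\ X \subset Z, Y \subset Z, #|Z| <= c * #|X|,
    #|Z| <= c * #|Y| & sparse M X Y].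
Proof.
move=> M0; pose N := 4 * (2 * M); have N1 : 1 < N by rewrite /N; lia.
have P0 : 0 < N ^ #|U| by rewrite expn_gt0 (ltnW N1).
exists (8 * N ^ #|U|) => [|T Z nUZ leZ]; first by rewrite muln_gt0.
have /card_gt0P[z0 _] : 0 < #|Z| by apply: leq_trans leZ; rewrite muln_gt0.
pose m := #|Z| %/ N ^ #|U|.
have m8 : 8 <= m by rewrite leq_divRL.
have leZm : #|Z| <= 2 * N ^ #|U| * m.
  rewrite [leqLHS](divn_eq #|Z| (N ^ #|U|)) -/m.
  have := ltn_pmod #|Z| P0; nia.
have [] := @greedy_embedding H T N m z0 Z (enum U) (fun=> Z) N1 (leq_trans _ m8) (enum_uniq _).
- by [].
- by [].
- by move=> h _; rewrite -cardE leq_trunc_div.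
- case=> f fm fZ; case: nUZ; exists f => [x y xU yU|x xU].
    by apply: fm; rewrite mem_enum.
  by apply: fZ; rewrite mem_enum.
case=> e [X [Y [ee fXY /andP[XZ YZ] leX leY]]].
have Y2 : 1 < #|Y| by apply: leq_trans leY; apply: leq_trans m8.
have [X' [Y' [[sX sY dXY cX cY] [f1 f2]]]] := few_sparse M0 Y2 fXY.
have cX' : m <= 4 * #|X'| by lia.
have cY' : m <= 4 * #|Y'| by lia.
have leZ4 k : m <= 4 * k -> #|Z| <= 8 * N ^ #|U| * k by nia.
have [eE|eE] := ee; [exists Y', X' | exists X', Y']; split; rewrite ?leZ4 //;
  try by [apply: subset_trans YZ | apply: subset_trans XZ].
- rewrite /sparse disjoint_sym dXY /=; apply/andP; split; apply/forall_inP => x xX.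
    move/forall_inP/(_ x xX): f2; congr (_ * _ <= _).
    by apply: eq_card => y; rewrite !inE eE.
  move/forall_inP/(_ x xX): f1; congr (_ * _ <= _).
  by apply: eq_card => y; rewrite !inE eE.
rewrite /sparse dXY /=; apply/andP; split; apply/forall_inP => x xX.
  move/forall_inP/(_ x xX): f1; congr (_ * _ <= _).
  by apply: eq_card => y; rewrite !inE eE.
move/forall_inP/(_ x xX): f2; congr (_ * _ <= _).
by apply: eq_card => y; rewrite !inE eE.
Qed.

(** Recursive splitting. The first pair is sparse with parameter [c * M], because the sets found
    later inside its two members have relative size at least [1 / c]. *)
Lemma sparse_family (H : tournament) (U : {set H}) M d : 0 < M -> exists2 c, 0 < c &
  forall (T : tournament) (Z : {set T}), ~ embeds U Z -> c <= #|Z| ->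
  exists s : seq {set T}, [/\ size s = 2 ^ d,
    {in s, forall X : {set T}, X \subset Z /\ #|Z| <= c * #|X|} & pairwise (sparse M) s].
Proof.
move=> M0; elim: d => [|d [c c0 IHd]].
  exists 1 => // T Z _ _; exists [:: Z]; split=> // X; rewrite inE => /eqP ->.
  by rewrite mul1n.
have [|c' c'0 pairZ] := @pair_sparse H U (c * M); first by rewrite muln_gt0 c0.
exists (c' * c) => [|T Z nUZ leZ]; first by rewrite muln_gt0 c'0.
have [|X [Y [XZ YZ cX cY sXY]]] := pairZ T Z nUZ.
  by apply: leq_trans leZ; rewrite leq_pmulr.
have [sub_nU le_c] : (forall W : {set T}, W \subset Z -> ~ embeds U W) /\
    (forall W : {set T}, #|Z| <= c' * #|W| -> c <= #|W|).
  split=> [W WZ /(embeds_sub WZ)//|W leW].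
  by rewrite -(leq_pmul2l c'0) (leq_trans leZ).
have [s [ss sX ps]] := IHd T X (sub_nU _ XZ) (le_c _ cX).
have [r [sr rY pr]] := IHd T Y (sub_nU _ YZ) (le_c _ cY).
exists (s ++ r); split.
- by rewrite size_cat ss sr expnS mul2n addnn.
- move=> W; rewrite mem_cat => /orP[/sX|/rY] [WX cW]; split.
  + exact: subset_trans XZ.
  + by rewrite -mulnA (leq_trans cX) // leq_pmul2l.
  + exact: subset_trans YZ.
  + by rewrite -mulnA (leq_trans cY) // leq_pmul2l.
rewrite pairwise_cat ps pr !andbT; apply/allrelP => A B /sX[AX cA] /rY[BY cB].
exact: sparse_sub sXY _ _ _ _ _.
Qed.

(** * Nine cells in a critical tournament *)

Definition linear_cell i := ~~ (1 < i < 6).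

Section Cells.
Variable T : tournament.

(** The indices are those of the cells containing [x] and [y]: forward and backward refer to the
    order of the cells, whichever vertex is named first. *)
Definition forth (i j : nat) (x y : T) := if i < j then arc x y else arc y x.
Definition back (i j : nat) (x y : T) := if i < j then arc y x else arc x y.

Lemma back_forth i j x y : x != y -> ~~ forth i j x y = back i j x y.
Proof. by move=> nxy; rewrite /forth /back (arcC nxy); case: ifP => _ //; rewrite negbK. Qed.

(* [V 2], ..., [V 5] are segments of a transitive set, whose size is of the order
   of [tr Z]; the other sets have size of the order of [#|Z|]. *)
Record cells (Z : {set T}) (V : nat -> {set T}) : Prop := Cells {
  cells_sub : forall i, i < 9 -> V i \subset Z;
  cells_gt0 : forall i, i < 9 -> 0 < #|V i|;
  cells_disj : forall i j x, i < 9 -> j < 9 -> i != j -> x \in V i -> x \notin V j;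
  cells_few : forall i j x, i < 9 -> j < 9 -> i != j -> x \in V i ->
    20 * #|[set y in V j | back i j x y]| <= #|V j|;
  cells_segment : forall i j x y, 1 < i -> i < j -> j < 6 -> x \in V i -> y \in V j ->
    arc x y;
  cells_back : forall i j (A B : {set T}), i < 9 -> j < 9 -> linear_cell i -> i != j ->
    A \subset V i -> B \subset V j -> #|V i| <= 12 * #|A| -> #|V j| <= 12 * #|B| ->
    exists x y, [/\ x \in A, y \in B & back i j x y]
}.

End Cells.

Lemma cells_exist (H : tournament) (U : {set H}) : exists2 K, 1 < K &
  forall (T : tournament) (Z : {set T}), ~ embeds U Z -> K <= #|Z| ->
    (forall X : {set T}, X \subset Z -> #|Z| <= K * #|X| -> K.-1 * tr Z <= K * tr X) ->
  exists V, cells Z V.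
Proof.
(* Six of the [2 ^ 3] sets are used. As [160 = 8 * 20], asking for density at most [1 / 20] towards
   a segment costs at most one eighth of a set. *)
have [c c0 fam] := @sparse_family H U 160 3 isT.
(* [24 * c] covers a twelfth of a cell that fills at least half of a set of the family;
   [128 = 2 ^ 7] gives [tr Z >= 7], which makes the four segments nonempty. *)
exists (24 * c + 128) => [|T Z nUZ leZ crit]; first by lia.
set K := 24 * c + 128 in leZ crit; set t := tr Z in crit.
have [|s [ss sZ ps]] := fam T Z nUZ; first by lia.
have t7 : 7 <= t by apply: tr_log; rewrite /=; lia.
pose z i := nth set0 s i.
have zin i : i < 6 -> z i \in s by move=> i6; rewrite mem_nth // ss; lia.
have zZ i : i < 6 -> z i \subset Z by move=> /zin/sZ[].
have zc i : i < 6 -> #|Z| <= c * #|z i| by move=> /zin/sZ[].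
have zs i j : i < j -> j < 6 -> sparse 160 (z i) (z j).
  by move=> ij j6; move/(pairwiseP set0): ps; apply; rewrite ?inE ?ss; lia.
(* Cell [i] lies in the set [z (sid i)]; the cells 2 to 5 share [z 2], whose largest chain is cut
   into four segments. *)
pose sid i := if i < 2 then i else if i < 6 then 2 else i - 3.
have sid6 i : i < 9 -> sid i < 6 by rewrite /sid; do ?case: ifP => ?; lia.
have sidlt i j : i < j -> sid i != sid j -> sid i < sid j.
  by rewrite /sid; do ?case: ifP => ?; lia.
have zdisj i j x : i < 9 -> j < 9 -> sid i != sid j -> x \in z (sid i) -> x \notin z (sid j).
  move=> i9 j9 nij xi; have nij' : i != j by apply: contraNneq nij => ->.
  have [ij|ji] : i < j \/ j < i by apply/orP; rewrite -neq_ltn.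
    by have /and3P[/disjointFr->] := zs _ _ (sidlt _ _ ij nij) (sid6 j j9).
  rewrite eq_sym in nij.
  by have /and3P[/disjointFl->] := zs _ _ (sidlt _ _ ji nij) (sid6 i i9).
have zfew i j x : i < 9 -> j < 9 -> sid i != sid j -> x \in z (sid i) ->
    160 * #|[set y in z (sid j) | back i j x y]| <= #|z (sid j)|.
  move=> i9 j9 nij xi; have nij' : i != j by apply: contraNneq nij => ->.
  rewrite /back; case: ltnP => [ij|ji].
    by have /and3P[_ /forall_inP/(_ x xi)] := zs _ _ (sidlt _ _ ij nij) (sid6 j j9).
  rewrite eq_sym in nij; have {}ji : j < i by rewrite ltn_neqAle eq_sym nij'.
  by have /and3P[_ _ /forall_inP/(_ x xi)] := zs _ _ (sidlt _ _ ji nij) (sid6 i i9).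
have [q cq sq] := tr_chain (z 2).
pose m := size q %/ 4.
pose seg k := take m (drop (k * m) q).
pose Q k := [set x in seg k].
have m4 : 4 * m <= size q by rewrite mulnC leq_trunc_div.
have cardQ k : k < 4 -> #|Q k| = m.
  move=> k4; rewrite cardsE (card_uniqP _) ?take_uniq ?drop_uniq ?(chain_uniq cq) //.
  by rewrite size_take_min size_drop; apply/minn_idPl; nia.
have Qz k : Q k \subset z 2.
  apply/subsetP => x; rewrite inE => /mem_take/mem_drop xq.
  by case/andP: cq => _ /allP/(_ x xq).
have segQ a b x y : a < b -> x \in Q a -> y \in Q b -> arc x y.
  move=> ab; rewrite !inE /seg => xa /mem_take yb.
  case/andP: cq => + _; rewrite -(cat_take_drop (b * m) q) pairwise_cat.
  case/andP=> /allrelP rel _; apply: rel yb.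
  move: xa; rewrite take_drop => /mem_drop.
  by rewrite -(@take_takel _ (m + a * m) (b * m)) ?[X in X <= _](_ : _ = a.+1 * m) ?leq_mul //
     => /mem_take.
have zK (A : {set T}) i : i < 6 -> A \subset z i -> #|z i| <= 24 * #|A| ->
    K.-1 * t <= K * tr A.
  move=> i6 Az leA; apply: crit; first by apply: subset_trans Az (zZ i i6).
  by apply: leq_trans (zc i i6) _; rewrite /K; nia.
have mK : K.-1 * t <= K * (4 * m + 3).
  apply: leq_trans (zK (z 2) 2 isT (subxx _) _) _; first by lia.
  rewrite leq_mul2l -sq {1}(divn_eq (size q) 4) -/m; apply/orP; right.
  have := ltn_pmod (size q) (isT : 0 < 4); lia.
pose V i := if 1 < i < 6 then Q (i - 2) else
  [set x in z (sid i) | [forall k : 'I_4,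
     20 * #|[set y in Q k | back i 2 x y]| <= #|Q k| ]].
have VQ i : 1 < i < 6 -> V i = Q (i - 2) by rewrite /V => ->.
have Vz i : V i \subset z (sid i).
  rewrite /V; case: ifP => [/andP[i1 i6]|_].
    by rewrite /sid ltnNge i1 i6; apply: Qz.
  by apply/subsetP => x; rewrite inE => /andP[].
have sid2 i : 1 < i < 6 -> sid i = 2 by case/andP=> i1 i6; rewrite /sid ltnNge i1 i6.
have sidne i j : linear_cell i -> i != j -> sid i != sid j.
  by rewrite /linear_cell /sid; do ?case: ifP => ?; lia.
have back2 i j x y : linear_cell i -> 1 < j < 6 -> back i j x y = back i 2 x y.
  by rewrite /back /linear_cell => li j26; congr (if _ then _ else _); lia.
(* Each of the four segments excludes at most one eighth of the set. *)
have Vc i : i < 9 -> linear_cell i -> #|z (sid i)| <= 2 * #|V i|.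
  move=> i9 li; rewrite /V ifN //; set A := [set x in _ | _].
  pose B (k : 'I_4) := [set x in z (sid i) | #|Q k| < 20 * #|[set y in Q k | back i 2 x y]|].
  have leB k : 8 * #|B k| <= #|z (sid i)|.
    have := @few_swap T 8 20 (fun y x => back i 2 x y) (Q k) (z (sid i)); apply.
    apply/forall_inP => y yQ.
    have ne2 : sid 2 != sid i by rewrite eq_sym sidne //; apply: contraNneq li => ->.
    have := zfew 2 i y isT i9 ne2 (subsetP (Qz k) y yQ).
    congr (_ * _ <= _); apply: eq_card => x; rewrite !inE /back.
    by case: (x \in _) => //=; case: ltngtP => // i2; rewrite -i2 in li.
  have : #|z (sid i)| <= #|A| + #|\bigcup_(k <- enum 'I_4) B k|.
    apply: leq_trans (leq_card_setU _ _); apply/subset_leq_card/subsetP => x xz.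
    rewrite !inE xz /= -implyNb; apply/implyP => /forallPn[k nk].
    rewrite big_enum /=; apply/bigcupP; exists k => //.
    by rewrite inE xz ltnNge.
  have := card_bigcup_le (enum 'I_4) B; set b := #|\bigcup_(k <- _) _|.
  rewrite !big_enum /= !big_ord_recl big_ord0 /=.
  by have := leB ord0; have := leB (lift ord0 ord0);
     have := leB (lift ord0 (lift ord0 ord0));
     have := leB (lift ord0 (lift ord0 (lift ord0 ord0))); lia.
have Vcard i : i < 9 -> linear_cell i -> #|Z| <= 2 * c * #|V i|.
  move=> i9 li; apply: leq_trans (zc _ (sid6 i i9)) _; rewrite mulnAC mulnC.
  by rewrite leq_pmul2r ?Vc.
have Vdisj i j x : i < 9 -> j < 9 -> i != j -> x \in V i -> x \notin V j.
  move=> i9 j9 nij xi; have [ls|] := boolP (linear_cell i || linear_cell j).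
    have nsid : sid i != sid j.
      by case/orP: ls => l; [exact: sidne | rewrite eq_sym sidne // eq_sym].
    have := zdisj i j x i9 j9 nsid (subsetP (Vz i) x xi).
    by apply: contra; apply: (subsetP (Vz j)).
  rewrite negb_or !negbK => /andP[qi qj]; rewrite !VQ // in xi *.
  apply/negP => xj; have [ij|ji] : i < j \/ j < i by apply/orP; rewrite -neq_ltn.
    have /segQ/(_ xi xj) : i - 2 < j - 2 by lia.
    by rewrite arc_irr.
  have /segQ/(_ xj xi) : j - 2 < i - 2 by lia.
  by rewrite arc_irr.
have Vseg i j x y : 1 < i -> i < j -> j < 6 -> x \in V i -> y \in V j -> arc x y.
  move=> i1 ij j6; rewrite !VQ ?i1 ?j6 ?(ltn_trans i1 ij) ?(ltn_trans ij j6) //.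
  by apply: segQ; lia.
exists V; split=> //.
- by move=> i i9; apply: subset_trans (Vz i) (zZ _ (sid6 i i9)).
- move=> i i9; have [qi|li] := boolP (1 < i < 6).
    rewrite VQ // cardQ; last by lia.
    by rewrite lt0n; apply: contraTneq mK => ->; rewrite -ltnNge /K; nia.
  have := Vcard i i9 li; case: posnP => // ->; rewrite muln0; lia.
- move=> i j x i9 j9 nij xi; have [qi|li] := boolP (1 < i < 6); last first.
    have [qj|lj] := boolP (1 < j < 6).
      move: xi; rewrite {1}/V ifN // inE => /andP[_ /forallP].
      have j4 : j - 2 < 4 by lia.
      move/(_ (Ordinal j4)); rewrite VQ //=; congr (_ * _ <= _).
      by apply: eq_card => y; rewrite !inE back2.
    have := zfew i j x i9 j9 (sidne i j li nij) (subsetP (Vz i) x xi).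
    have := Vc j j9 lj.
    have : #|[set y in V j | back i j x y]| <= #|[set y in z (sid j) | back i j x y]|.
      apply/subset_leq_card/subsetP => y; rewrite !inE => /andP[yj ->].
      by rewrite (subsetP (Vz j)).
    lia.
  have [qj|lj] := boolP (1 < j < 6).
    rewrite (_ : [set y in _ | _] = set0) ?cards0 //; apply/setP => y; rewrite !inE.
    apply/negP => /andP[yj]; rewrite /back; case: ltnP => ij.
      by rewrite (arc_asym (Vseg i j x y _ _ _ _ _)) //; lia.
    by rewrite (arc_asym (Vseg j i y x _ _ _ _ _)) //; lia.
  have nij' : sid i != sid j by rewrite eq_sym sidne // eq_sym.
  have := zfew i j x i9 j9 nij' (subsetP (Vz i) x xi).
  have := Vc j j9 lj.
  have : #|[set y in V j | back i j x y]| <= #|[set y in z (sid j) | back i j x y]|.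
    apply/subset_leq_card/subsetP => y; rewrite !inE => /andP[yj ->].
    by rewrite (subsetP (Vz j)).
  lia.
move=> i j A B i9 j9 li nij AV BV cA cB.
have [/exists_inP[x xA /exists_inP[y yB bxy]]|nback] :=
  boolP [exists x in A, [exists y in B, back i j x y]].
  by exists x, y.
(* With no backward arc between them, chains of [A] and [B] concatenate, so [tr A + tr B <= t],
   whereas criticality gives [tr A >= (1 - 1/K) * t]. *)
exfalso; have fAB x y : x \in A -> y \in B -> forth i j x y.
  move=> xA yB; have nxy : x != y.
    have := Vdisj i j x i9 j9 nij (subsetP AV x xA).
    by apply: contraNneq => ->; apply: (subsetP BV).
  rewrite -[forth _ _ _ _]negbK back_forth //; apply: contra nback => bxy.
  by apply/exists_inP; exists x => //; apply/exists_inP; exists y.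
have zsub k (C : {set T}) : k < 9 -> C \subset V k -> C \subset Z.
  by move=> k9 CV; apply: subset_trans CV (subset_trans (Vz k) (zZ _ (sid6 k k9))).
have leAB : tr A + tr B <= t.
  move: fAB; rewrite /forth; case: ltnP => _ /= fAB.
    exact: trU (zsub i A i9 AV) (zsub j B j9 BV) fAB.
  rewrite addnC; apply: trU (zsub j B j9 BV) (zsub i A i9 AV) _ => x y xB yA.
  exact: fAB.
have lin k (C : {set T}) : k < 9 -> linear_cell k -> C \subset V k -> #|V k| <= 12 * #|C| ->
    K.-1 * t <= K * tr C.
  move=> k9 lk CV leC; apply: (zK C _ (sid6 k k9)); first exact: subset_trans (Vz k).
  by apply: leq_trans (Vc k k9 lk) _; lia.
have leA := lin i A i9 li AV cA.
have [qj|lj] := boolP (1 < j < 6); last first.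
  by have := lin j B j9 lj BV cB; rewrite /K in leA *; nia.
(* [B] is part of a chain, so [tr B] is at least [m / 12], which exceeds [t / K]. *)
have leB : #|B| <= tr B.
  have Bq x : x \in B -> x \in q.
    by move/(subsetP BV); rewrite VQ // inE => /mem_take/mem_drop.
  have <- : size [seq x <- q | x \in B] = #|B|.
    rewrite -(card_uniqP (filter_uniq _ (chain_uniq cq))); apply: eq_card => x.
    by rewrite mem_filter; case: (boolP (x \in B)) => // /Bq.
  apply: tr_ge; rewrite /chain filter_all andbT.
  by case/andP: cq => pq _; apply: subseq_pairwise pq; apply: filter_subseq.
move: cB; rewrite VQ // cardQ; last by lia.
move=> cB; rewrite /K in leA mK; nia.
Qed.

Lemma EH_cells (H : tournament) (U : {set H}) :
  (forall (T : tournament) (Z : {set T}) V, cells Z V -> embeds U Z) -> EH U.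
Proof.
move=> cellsU; have [K K1 cellsE] := cells_exist U.
apply: (EH_core K1) => T Z nUZ leZ.
have [/exists_inP[X XZ crit]|ncrit] := boolP [exists (X : {set T} | X \subset Z),
    (#|Z| <= K * #|X|) && (K * tr X < K.-1 * tr Z)]; first by exists X.
have [X XZ leX|V cV] := cellsE T Z nUZ leZ; last by case: nUZ; apply: cellsU cV.
rewrite leqNgt; apply: contra ncrit => ltX.
by apply/exists_inP; exists X; rewrite ?leX.
Qed.

(** * Realizing prescribed backward arcs star by star *)

Section Patterns.
Variable B : seq (nat * nat).

(** Symmetric in [i] and [j]. Cells are numbered from 0, labels in [B] from 1. *)
Definition is_back i j := ((maxn i j).+1, (minn i j).+1) \in B.

Definition pattern_arc i j :=
  if i < j then (j.+1, i.+1) \notin B else (j < i) && ((i.+1, j.+1) \in B).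

Definition placed (T : tournament) i j (x y : T) :=
  if is_back i j then back i j x y else forth i j x y.

Lemma placed_sym (T : tournament) i j (x y : T) : i != j -> placed i j x y = placed j i y x.
Proof.
rewrite /placed /is_back maxnC minnC /back /forth.
by case: ltngtP => // _ _; case: ifP.
Qed.

Lemma placedP (T : tournament) i j (x y : T) : i != j -> placed i j x y ->
  arc x y = pattern_arc i j.
Proof.
rewrite /placed /is_back /pattern_arc /back /forth; case: ltngtP => // ij _.
  by case: ifP => // _ /arc_asym.
by case: ifP => // _ /arc_asym.
Qed.

(** Conditions for adding a star to the placed cells [D]. A centre with leaves is outside the
    segments, since [cells_back] needs a linear cell; several leaves are all in segments, where the
    arcs between them are automatically forward. *)
Definition star_ok (D : seq nat) c js :=
  [&& uniq (c :: js ++ D), all (gtn 9) (c :: js ++ D), (js == [::]) || linear_cell c,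
      (size js <= 1) || all (fun j => ~~ linear_cell j) js, size js <= 4,
      all (is_back c) js, all (fun j => all (fun i => ~~ is_back i j) js) js &
      all (fun i => all (fun d => ~~ is_back i d) D) (c :: js)].

Fixpoint stars_ok D (L : seq (nat * seq nat)) :=
  if L is (c, js) :: L' then star_ok D c js && stars_ok (c :: js ++ D) L'
  else all [in D] (iota 0 9).

Section Extend.
Variables (T : tournament) (Z : {set T}) (V : nat -> {set T}).
Hypothesis cV : cells Z V.

Definition realizes (D : seq nat) (p : nat -> T) :=
  {in D, forall i, p i \in V i} /\
  {in D &, forall i j, i != j -> placed i j (p i) (p j)}.

(** At most 9 placed vertices each exclude a twentieth of a cell, so at least half of each new cell
    is forward to all of them. For each leaf, less than a twelfth of the cell of the centre lacks a
    backward neighbour among the candidates; four leaves exclude at most a third, so a centre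
    remains. *)
Lemma extend_star D p c js : realizes D p -> star_ok D c js ->
  exists2 p', realizes (c :: js ++ D) p' & {in D, p' =1 p}.
Proof.
case=> pV pB /and5P[uD /allP D9 jsl jsq /and4P[js4 jsB jsF DF]].
pose R j := [set y in V j | all (fun i => forth i j (p i) y) D].
have RV j : R j \subset V j by apply/subsetP => y; rewrite inE => /andP[].
have {}uD : [/\ c \notin js, c \notin D, uniq js, uniq D & {in js, forall j, j \notin D}].
  move: uD; rewrite /= mem_cat negb_or cat_uniq => /andP[/andP[-> ->] /and3P[-> /hasPn jD ->]].
  by split=> // j js'; apply/negP => /jD; rewrite js'.
case: uD => cjs cD ujs uD jsD.
have D9' i : i \in D -> i < 9 by move=> iD; apply: D9; rewrite inE mem_cat iD !orbT.
have js9 i : i \in js -> i < 9 by move=> iD; apply: D9; rewrite inE mem_cat iD !orbT.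
have c9 : c < 9 by apply: D9; rewrite mem_head.
have sD : size D <= 9.
  rewrite -[9](size_iota 0); apply: uniq_leq_size => // i /D9' i9; by rewrite mem_iota.
have leR j : j < 9 -> j \notin D -> #|V j| <= 2 * #|R j|.
  move=> j9 jD; pose F i := [set y in V j | back i j (p i) y].
  have leF : 20 * #|\bigcup_(i <- D) F i| <= 9 * #|V j|.
    apply: leq_trans (_ : size D * #|V j| <= _); last by rewrite leq_mul2r sD orbT.
    apply: leq_trans (_ : \sum_(i <- D) 20 * #|F i| <= _).
      by rewrite -big_distrr leq_mul2l card_bigcup_le orbT.
    apply: sum_seq_le => i iD; apply: (cells_few cV (D9' i iD) j9 _ (pV i iD)).
    by apply: contraNneq jD => <-.
  have : #|V j| <= #|R j| + #|\bigcup_(i <- D) F i|.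
    apply: leq_trans (leq_card_setU _ _); apply/subset_leq_card/subsetP => y yV.
    rewrite inE [y \in R j]inE yV /= -implyNb; apply/implyP => /allPn[i iD nfi].
    rewrite (big_rem i) //= inE inE yV -back_forth ?nfi //.
    have nij : i != j by apply: contraNneq jD => <-.
    by apply: contraTneq yV => <-; apply: (cells_disj cV (D9' i iD) j9 nij (pV i iD)).
  by move: leF; clear; lia.
pose bad j := [set a in R c | ~~ [exists y in R j, back c j a y]].
have leb : 12 * #|\bigcup_(j <- js) bad j| <= 4 * #|V c|.
  apply: leq_trans (_ : size js * #|V c| <= _); last by rewrite leq_mul2r js4 orbT.
  apply: leq_trans (_ : \sum_(j <- js) 12 * #|bad j| <= _).
    by rewrite -big_distrr leq_mul2l card_bigcup_le orbT.
  apply: sum_seq_le => j jjs; rewrite leqNgt; apply/negP => /ltnW leV.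
  have lc : linear_cell c by case/orP: jsl jjs => // /eqP->.
  have ncj : c != j by apply: contraNneq cjs => ->.
  have bV : bad j \subset V c.
    by apply: subset_trans (RV c); apply/subsetP => a; rewrite inE => /andP[].
  have leRj : #|V j| <= 12 * #|R j| by have := leR j (js9 j jjs) (jsD j jjs); clear; lia.
  have [a [y [ab yR aby]]] := cells_back cV c9 (js9 j jjs) lc ncj bV (RV j) leV leRj.
  by move: ab; rewrite inE => /andP[_ /exists_inP]; apply; exists y.
have [a aR anb] : exists2 a, a \in R c & forall j, j \in js -> a \notin bad j.
  have [|a aR nab] := subsetPn (_ : ~~ (R c \subset \bigcup_(j <- js) bad j)).
    apply/negP => /subset_leq_card; have := leR c c9 cD.
    by have := cells_gt0 cV c9; move: leb; clear; lia.
  exists a => // j jjs; apply: contra nab => aj.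
  by rewrite (big_rem j) //= inE aj.
(* By the choice of [a], the default value is not reached for a leaf [j]. *)
pose q j := odflt a [pick y in R j | back c j a y].
have qP j : j \in js -> q j \in R j /\ back c j a (q j).
  move=> jjs; rewrite /q; case: pickP => [y /andP[] //|noy].
  have := anb j jjs; rewrite inE aR negbK => /exists_inP[y yR yb].
  by have := noy y; rewrite yR yb.
pose p' i := if i == c then a else if i \in js then q i else p i.
have p'c : p' c = a by rewrite /p' eqxx.
have p'js j : j \in js -> p' j = q j.
  by move=> jjs; rewrite /p' jjs; case: eqP => // jc; rewrite -jc jjs in cjs.
have p'D i : i \in D -> p' i = p i.
  move=> iD; rewrite /p'; case: eqP => [ic|_]; first by rewrite -ic iD in cD.
  by case: ifP => // /jsD; rewrite iD.
have p'R i : i \in c :: js -> p' i \in R i.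
  by rewrite inE => /orP[/eqP->|ijs]; rewrite ?p'c // p'js //; case: (qP i ijs).
exists p' => //; split=> [i|].
  rewrite -cat_cons mem_cat => /orP[/p'R|iD]; first exact: (subsetP (RV i)).
  by rewrite p'D ?pV.
have newD i d : i \in c :: js -> d \in D -> placed i d (p' i) (p' d).
  move=> ijs dD; have nid : i != d.
    apply: contraTneq dD => <-; move: ijs; rewrite inE => /orP[/eqP->//|/jsD//].
  rewrite placed_sym // (p'D d dD) /placed.
  have /allP/(_ d dD) := allP DF i ijs; rewrite /is_back maxnC minnC => /negPf->.
  by have := p'R i ijs; rewrite inE => /andP[_ /allP/(_ d dD)].
have cnew j : j \in js -> placed c j (p' c) (p' j).
  move=> jjs; rewrite /placed (allP jsB) // p'c p'js //.
  by case: (qP j jjs).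
have newnew i j : i \in js -> j \in js -> i != j -> placed i j (p' i) (p' j).
  move=> ijs jjs nij; case/orP: jsq => [|/allP jsq].
    case: (js) ijs jjs => // k [|//]; rewrite !inE => /eqP ik /eqP jk _.
    by rewrite ik jk eqxx in nij.
  have /allP/(_ i ijs)/negPf := allP jsF j jjs; rewrite /placed => ->.
  have VV k : k \in js -> p' k \in V k.
    by move=> kjs; apply: (subsetP (RV k)); apply: p'R; rewrite inE kjs orbT.
  have := jsq i ijs; have := jsq j jjs; rewrite /linear_cell !negbK => /andP[j1 j6] /andP[i1 i6].
  rewrite /forth; case: ltnP => ij; first exact: (cells_segment cV i1 ij j6 (VV i ijs) (VV j jjs)).
  have ji : j < i by rewrite ltn_neqAle eq_sym nij.
  exact: (cells_segment cV j1 ji i6 (VV j jjs) (VV i ijs)).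
move=> i j; rewrite -!cat_cons !(mem_cat _ (c :: js)).
case/orP=> [inew|iD]; case/orP=> [jnew|jD] nij.
- move: inew jnew; rewrite !inE; case/orP=> [/eqP ic|ijs]; case/orP=> [/eqP jc|jjs].
  + by rewrite ic jc eqxx in nij.
  + by rewrite ic cnew.
  + by rewrite jc placed_sym ?cnew // -jc.
  + exact: newnew.
- exact: newD.
- by rewrite placed_sym // newD.
by rewrite !p'D ?pB.
Qed.

Lemma extend_stars L D p : realizes D p -> stars_ok D L ->
  exists2 p', (forall i, i < 9 -> p' i \in Z) &
    forall i j, i < 9 -> j < 9 -> arc (p' i) (p' j) = pattern_arc i j.
Proof.
elim: L D p => [|[c js] L IHL] D p rDp.
  rewrite /stars_ok => /allP sD; have D9 i : i < 9 -> i \in D.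
    by move=> i9; apply: sD; rewrite mem_iota.
  case: rDp => pV pB; exists p => [i i9|i j i9 j9].
    by apply: (subsetP (cells_sub cV i9)); apply: pV; apply: D9.
  have [->|nij] := eqVneq i j; first by rewrite arc_irr /pattern_arc ltnn.
  by apply: placedP => //; apply: pB; rewrite ?D9.
by rewrite /= => /andP[/(extend_star rDp)[p' rDp' _]]; apply: IHL rDp'.
Qed.

End Extend.
End Patterns.

(** [cs] lists the cells of the six vertices. It need not be increasing, so a tournament may be
    placed in another of its orderings. *)
Definition pattern_sub (B B' : seq (nat * nat)) (cs : seq nat) :=
  all (fun i => (nth 0 cs i < 9) &&
    all (fun j => pattern_arc B i j == pattern_arc B' (nth 0 cs i) (nth 0 cs j)) (iota 0 6))
  (iota 0 6).

Lemma pattern_embeds B B' cs (T : tournament) (Z : {set T}) (p : nat -> T) :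
    (forall i, i < 9 -> p i \in Z) ->
    (forall i j, i < 9 -> j < 9 -> arc (p i) (p j) = pattern_arc B' i j) ->
  pattern_sub B B' cs -> embeds [set: backward_tournament 6 B] Z.
Proof.
move=> pZ pB /allP sub.
have iI (i : 'I_6) : (i : nat) \in iota 0 6 by rewrite mem_iota ltn_ord.
exists (fun i : 'I_6 => p (nth 0 cs i)) => [i j _ _|i _].
  have /andP[i9 /allP/(_ j (iI j))/eqP ij] := sub i (iI i).
  by have /andP[j9 _] := sub j (iI j); rewrite pB // -ij.
by have /andP[i9 _] := sub i (iI i); apply: pZ.
Qed.

(** * Galaxies *)

Lemma EH_galaxy B B' L cs : stars_ok B' [::] L -> pattern_sub B B' cs ->
  EH [set: backward_tournament 6 B].
Proof.
move=> Lok sub; apply: EH_cells => T Z V cV.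
have /card_gt0P[z0 _] := cells_gt0 cV (isT : 0 < 9).
have [|p pZ pB] := extend_stars cV (p := fun=> z0) _ Lok; first by split.
exact: pattern_embeds pZ pB sub.
Qed.

(** Stars without leaves fill the remaining cells, as [stars_ok] asks for all nine. *)
Definition singletons (D : seq nat) : seq (nat * seq nat) :=
  [seq (i, [::]) | i <- iota 0 9 & i \notin D].

(* Leaves in the segments [2, ..., 5], centres in the sets [6, 7, 8]. *)
Definition galaxy_stars (B : seq (nat * nat)) : seq (nat * seq nat) :=
  let L := [seq (c, [seq j <- [:: 2; 3; 4; 5] | is_back B c j]) | c <- [:: 6; 7; 8]] in
  L ++ singletons (flatten [seq u.1 :: u.2 | u <- L]).

Definition transport_back (B : seq (nat * nat)) (cs : seq nat) :=
  [seq ((nth 0 cs u.1.-1).+1, (nth 0 cs u.2.-1).+1) | u <- B].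

Definition is_galaxy (B : seq (nat * nat)) (cs : seq nat) :=
  stars_ok (transport_back B cs) [::] (galaxy_stars (transport_back B cs)) &&
  pattern_sub B (transport_back B cs) cs.

Lemma is_galaxy_EH B cs : is_galaxy B cs -> EH [set: backward_tournament 6 B].
Proof. by case/andP; apply: EH_galaxy. Qed.

(** * Two centres joined by a backward arc *)

Lemma realizes_pairwise B (T : tournament) (V : nat -> {set T}) D p :
    {in D, forall i, p i \in V i} ->
  pairwise (fun i j => placed B i j (p i) (p j)) D -> realizes B V D p.
Proof.
move=> pV pD; split=> // i j iD jD nij.
elim: D iD jD pD {pV} => // k D IHD; rewrite !inE /= => iD jD /andP[/allP kD pD].
case/orP: iD => [/eqP ik|iD]; case/orP: jD => [/eqP jk|jD].
- by rewrite ik jk eqxx in nij.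
- by rewrite ik kD.
- by rewrite placed_sym // jk kD.
exact: IHD.
Qed.

(** The backward arcs among these four cells form the path [s], 8, 0, [t]. *)
Definition double_star (B : seq (nat * nat)) s t :=
  [&& is_back B 0 8, ~~ is_back B 0 s, is_back B 8 s, is_back B 0 t,
      ~~ is_back B 8 t & ~~ is_back B s t].

Definition triangle (B : seq (nat * nat)) i :=
  [&& is_back B 0 8, is_back B 0 i & is_back B 8 i].

(** At least five sixths of each of the cells 0 and 8 have backward neighbours in both segments, so
    some backward arc joins two such vertices [a] and [b]. Take a backward neighbour [x] of [b] in
    [V s] and [y] of [a] in [V t]: one of them is common to [a] and [b], or there is a path. *)
Lemma two_centers (T : tournament) (Z : {set T}) V s t : cells Z V ->
    1 < s -> s < t -> t < 6 ->
  exists a b, [/\ a \in V 0, b \in V 8, arc b a &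
    (exists i x, [/\ i \in [:: s; t], x \in V i, arc b x & arc x a]) \/
    exists x y, [/\ x \in V s, y \in V t, arc b x && arc a x & arc y a && arc y b]].
Proof.
move=> cV s1 st t6; have [s6 t1] := (ltn_trans st t6, ltn_trans s1 st).
have [s9 t9] : s < 9 /\ t < 9 by lia.
pose good c := [set a in V c | [exists x in V s, back c s a x] && [exists x in V t, back c t a x]].
have goodV c : good c \subset V c by apply/subsetP => x; rewrite inE => /andP[].
have leg c : c \in [:: 0; 8] -> #|V c| <= 12 * #|good c|.
  move=> c08; have [c9 lc] : c < 9 /\ linear_cell c by case/or3P: c08 => // /eqP->.
  pose bad i := [set a in V c | ~~ [exists x in V i, back c i a x]].
  have lebad i : 1 < i -> i < 6 -> 12 * #|bad i| <= #|V c|.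
    move=> i1 i6; rewrite leqNgt; apply/negP => /ltnW leV.
    have bV : bad i \subset V c by apply/subsetP => x; rewrite inE => /andP[].
    have i9 : i < 9 by apply: leq_trans i6 _.
    have nci : c != i by apply: contraNneq lc => ->; rewrite i1 i6.
    have [a [x [ai xi axi]]] :=
      cells_back cV c9 i9 lc nci bV (subxx _) leV (leq_pmull #|V i| (isT : 0 < 12)).
    by move: ai; rewrite inE => /andP[_ /exists_inP]; apply; exists x.
  have : #|V c| <= #|good c| + (#|bad s| + #|bad t|).
    apply: leq_trans (leq_add (leqnn _) (leq_card_setU _ _)).
    apply: leq_trans (leq_card_setU _ _); apply/subset_leq_card/subsetP => x xV.
    by rewrite !inE xV /= -negb_and orbN.
  by have := lebad s s1 s6; have := lebad t t1 t6; clear; lia.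
have [a [b [ag bg /= ab]]] :=
  cells_back cV (isT : 0 < 9) (isT : 8 < 9) isT isT (goodV 0) (goodV 8) (leg 0 isT) (leg 8 isT).
rewrite /back /= in ab; exists a, b.
move: ag bg; rewrite !inE => /and3P[aV _ /exists_inP[y yV ay]] /and3P[bV /exists_inP[x xV bx] _].
rewrite aV bV ab; split=> //; move: ay bx.
rewrite /back (ltn_trans _ t1) // ltnNge (leq_trans (ltnW s6)) //= => ya bx.
have [xa|nxa] := boolP (arc x a).
  by left; exists s, x; rewrite inE eqxx.
have [bY|nby] := boolP (arc b y).
  by left; exists t, y; rewrite !inE eqxx orbT.
right; exists x, y; split=> //; rewrite ?bx ?ya /= arcC //.
  have ns0 : s != 0 by rewrite -lt0n (ltn_trans _ s1).
  by apply: contraNneq (cells_disj cV s9 (isT : 0 < 9) ns0 xV) => ->.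
have nt8 : t != 8 by rewrite neq_ltn (leq_trans t6).
by apply: contraNneq (cells_disj cV t9 (isT : 8 < 9) nt8 yV) => <-.
Qed.

(** The placements [Bs] and [Bt] serve a common backward neighbour in segment [s] or [t], and [Bp]
    serves the path; stars complete each of them. *)
Lemma EH_two_centers B s t cs ct Bs Bt Bp cp Ls Lt Lp : 1 < s -> s < t -> t < 6 ->
    [&& triangle Bs s, stars_ok Bs [:: 0; s; 8] Ls & pattern_sub B Bs cs] ->
    [&& triangle Bt t, stars_ok Bt [:: 0; t; 8] Lt & pattern_sub B Bt ct] ->
    [&& double_star Bp s t, stars_ok Bp [:: 0; s; t; 8] Lp & pattern_sub B Bp cp] ->
  EH [set: backward_tournament 6 B].
Proof.
move=> s1 st t6 tris trit pathst; have t1 := ltn_trans s1 st.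
apply: EH_cells => T Z V cV; have [a [b [aV bV ba]]] := two_centers cV s1 st t6.
have tri i x Bi Li ci : 1 < i -> i < 6 -> x \in V i -> arc b x -> arc x a ->
    [&& triangle Bi i, stars_ok Bi [:: 0; i; 8] Li & pattern_sub B Bi ci] ->
    embeds [set: backward_tournament 6 B] Z.
  move=> i1 i6 xV bx xa /and3P[/and3P[b08 b0i b8i] Lok sub].
  pose p k := if k == 0 then a else if k == 8 then b else x.
  have [i0 i8] : 0 < i /\ i < 8 by move: i1 i6; clear; lia.
  have pi : p i = x by rewrite /p gtn_eqF // ltn_eqF.
  have [|q qZ qB] := extend_stars cV (_ : realizes Bi V [:: 0; i; 8] p) Lok;
    last exact: pattern_embeds qZ qB sub.
  apply: realizes_pairwise.
    by move=> k; rewrite !inE => /or3P[] /eqP-> //; rewrite pi.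
  rewrite /= !andbT pi /placed b08 b0i /p /=; rewrite /is_back maxnC minnC in b8i.
  by rewrite /is_back b8i /back i0 i8 ba bx xa.
case=> [[i [x [ist xV bx xa]]]|[x [y [xV yV /andP[bx ax] /andP[ya yb]]]]].
  by move: ist; rewrite !inE => /orP[] /eqP ei; subst i;
    [apply: tri xV bx xa tris | apply: tri xV bx xa trit]; rewrite ?(ltn_trans st).
case/and3P: pathst => /and5P[b08 b0s b8s b0t /andP[b8t bst]] Lok sub.
pose p k := if k == 0 then a else if k == 8 then b else if k == s then x else y.
have [s0 s8 t0 t8] : [/\ 0 < s, s < 8, 0 < t & t < 8].
  by move: s1 st t6; clear; split; lia.
have ps : p s = x by rewrite /p gtn_eqF // ltn_eqF // eqxx.
have pt : p t = y by rewrite /p gtn_eqF // ltn_eqF // gtn_eqF.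
have [|q qZ qB] := extend_stars cV (_ : realizes Bp V [:: 0; s; t; 8] p) Lok;
  last exact: pattern_embeds qZ qB sub.
apply: realizes_pairwise.
  by move=> k; rewrite !inE => /or4P[] /eqP-> //; rewrite ?ps ?pt.
rewrite /is_back maxnC minnC in b8s; rewrite /is_back maxnC minnC in b8t.
rewrite /= !andbT ps pt /placed b08 (negPf b0s) b0t (negPf bst) /p /=.
rewrite /is_back b8s (negPf b8t) /back /forth s0 t0 s8 t8 st ba ax ya bx yb.
by rewrite (cells_segment cV s1 st t6 xV yV).
Qed.

(** The path placement keeps the given ordering, with [a] and [b] as first and last vertex. For the
    triangles, another ordering of the tournament has a triangle and one disjoint arc as backward
    arcs. The same holds for [EH_N3]. *)
Lemma EH_N1 : EH [set: backward_tournament 6 [:: (5, 1); (6, 1); (6, 3); (4, 2)]].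
Proof.
apply: (@EH_two_centers _ 3 5 [:: 0; 2; 6; 1; 8; 3] [:: 0; 2; 6; 1; 8; 5]
  [:: (9, 1); (4, 1); (9, 4); (7, 2)] [:: (9, 1); (6, 1); (9, 6); (7, 2)]
  [:: (9, 1); (6, 1); (9, 4); (5, 2)] [:: 0; 1; 3; 4; 5; 8]
  ((1, [:: 6]) :: singletons [:: 0; 1; 3; 6; 8])
  ((1, [:: 6]) :: singletons [:: 0; 1; 5; 6; 8])
  ((1, [:: 4]) :: singletons [:: 0; 1; 3; 4; 5; 8])); by vm_compute.
Qed.

Lemma EH_N3 : EH [set: backward_tournament 6 [:: (4, 1); (6, 1); (6, 2)]].
Proof.
apply: (@EH_two_centers _ 2 4 [:: 2; 0; 6; 1; 7; 8] [:: 4; 0; 6; 1; 7; 8]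
  [:: (9, 1); (3, 1); (9, 3); (7, 2)] [:: (9, 1); (5, 1); (9, 5); (7, 2)]
  [:: (9, 1); (5, 1); (9, 3)] [:: 0; 2; 3; 4; 5; 8]
  ((1, [:: 6]) :: singletons [:: 0; 1; 2; 6; 8])
  ((1, [:: 6]) :: singletons [:: 0; 1; 4; 6; 8])
  (singletons [:: 0; 2; 4; 8])); by vm_compute.
Qed.

(** In all these orderings the leaves precede the centres, so leaves fit into the segments 2 to 5
    and centres into the cells 6 to 8. *)
Definition galaxies : seq (seq (nat * nat) * seq nat) :=
  let cs := [:: 2; 3; 4; 5; 6; 7] in
  [:: ([:: (4, 1); (5, 2); (6, 3)], [:: 2; 3; 4; 6; 7; 8]);
      ([:: (5, 1); (6, 2); (5, 3); (6, 4)], cs);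
      ([:: (5, 1); (6, 2); (5, 3)], cs);
      ([:: (6, 1); (5, 2); (6, 3)], cs);
      ([:: (5, 1); (6, 2); (6, 4)], cs);
      ([:: (5, 1); (6, 2); (5, 4)], cs);
      ([:: (6, 1); (5, 2); (6, 4)], cs);
      ([:: (5, 1); (6, 3); (5, 4)], cs);
      ([:: (5, 1); (6, 3)], cs)].

Lemma galaxies_ok : all (fun u => is_galaxy u.1 u.2) galaxies.
Proof. by vm_compute. Qed.

(** * Enumeration of small tournaments along Hamiltonian paths *)

(** Rédei's theorem, by insertion. It leaves [2 ^ 10] instead of [2 ^ 15] codes to examine on six
    vertices. *)
Lemma hamiltonian_path (T : tournament) (s : seq T) : uniq s ->
  exists2 s', perm_eq s s' & sorted (@arc T) s'.
Proof.
have ins x (r : seq T) y : x != y -> x \notin r -> arc y x -> path (@arc T) y r ->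
    exists2 r', perm_eq (x :: r) r' & path (@arc T) y r'.
  elim: r y => [|z r IHr] y nxy; first by move=> _ yx _; exists [:: x]; rewrite //= yx.
  rewrite inE negb_or => /andP[nxz nxr] yx /= /andP[yz zr].
  have [xz|zx] := boolP (arc x z).
    by exists [:: x, z & r]; rewrite //= yx xz.
  rewrite -(arcC nxz) in zx; have [r' rr' zr'] := IHr z nxz nxr zx zr.
  exists (z :: r'); rewrite /= ?yz //.
  apply: perm_trans (_ : perm_eq [:: z, x & r] _); rewrite ?perm_cons //.
  by rewrite -[[:: x, z & r]]/([:: x] ++ [:: z] ++ r) perm_catCA.
elim: s => [|x s IHs] /=; first by exists [::].
case/andP=> nxs /IHs[[|y r] pr sr].
  by exists [:: x] => //; rewrite perm_cons.
have : x \notin y :: r by rewrite -(perm_mem pr).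
rewrite inE negb_or => /andP[nxy nxr]; have [xy|yx] := boolP (arc x y).
  by exists [:: x, y & r]; rewrite ?perm_cons //= xy.
rewrite -(arcC nxy) in yx; have [r' rr' yr'] := ins x r y nxy nxr yx sr.
exists (y :: r') => //; apply: perm_trans (_ : perm_eq [:: y, x & r] _).
  by rewrite perm_sym -[[:: y, x & r]]/([:: y] ++ [:: x] ++ r) perm_catCA perm_cons perm_sym.
by rewrite perm_cons.
Qed.

(** The adjacency matrix above the diagonal, row by row. *)
Fixpoint code (X : Type) (e : rel X) (s : seq X) : seq (seq bool) :=
  if s is x :: s' then map (e x) s' :: code e s' else [::].

Definition entry (R : seq (seq bool)) i j :=
  if i < j then nth false (nth [::] R i) (j - i.+1)
  else (j < i) && ~~ nth false (nth [::] R j) (i - j.+1).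

Lemma nth_code (X : Type) (e : rel X) x0 (s : seq X) i j :
  i < j -> j < size s -> nth false (nth [::] (code e s) i) (j - i.+1) = e (nth x0 s i) (nth x0 s j).
Proof.
elim: s i j => // x s IHs [|i] [|j] //=.
  by move=> _ js; rewrite subn1 /= (nth_map x0).
by rewrite !ltnS subSS => ij js; rewrite IHs.
Qed.

Lemma entry_code (X : eqType) (e : rel X) x0 (s : seq X) :
    irreflexive e -> (forall x y, x != y -> e y x = ~~ e x y) -> uniq s ->
  forall i j, i < size s -> j < size s ->
  entry (code e s) i j = e (nth x0 s i) (nth x0 s j).
Proof.
move=> eI eC us i j is_ js; rewrite /entry; case: ltngtP => [ij|ji|->].
- exact: nth_code.
- by rewrite (nth_code e x0 ji is_) -eC // nth_uniq // ltn_eqF.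
by rewrite eI.
Qed.

Fixpoint bits n : seq (seq bool) :=
  if n is n'.+1 then [seq b :: l | b <- [:: true; false], l <- bits n'] else [:: [::]].

Lemma mem_bits l : l \in bits (size l).
Proof.
elim: l => // b l IHl; apply/allpairsP; exists (b, l); split=> //=.
by case: b; rewrite !inE.
Qed.

(* The first entry of each row is the arc to the next vertex of the path. *)
Fixpoint path_codes n : seq (seq (seq bool)) :=
  if n is n'.+1 then
    [seq r :: R | r <- (if n' is m.+1 then map (cons true) (bits m) else [:: [::]]),
                  R <- path_codes n']
  else [:: [::]].

Lemma mem_path_codes (X : Type) (e : rel X) (s : seq X) :
  sorted e s -> code e s \in path_codes (size s).
Proof.
elim: s => // x s IHs xs; apply/allpairsP; exists (map (e x) s, code e s); split=> //=.
  case: s xs {IHs} => //= y s /andP[-> _]; apply/map_f.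
  by have := mem_bits (map (e x) s); rewrite size_map.
by apply: IHs; apply: path_sorted xs.
Qed.

Definition has_module n R :=
  has (fun m => let W := mask m (iota 0 n) in
    [&& 1 < size W, size W < n &
      all (fun i => (i \in W) || all (fun w => entry R i w == entry R i (head 0 W)) W)
        (iota 0 n)]) (bits n).

Definition path_starts B p :=
  [seq x <- iota 0 6 | (x \notin p) && (if p is y :: _ then pattern_arc B x y else true)].

(** Hamiltonian paths of the [n]-vertex subtournaments of the pattern, whose codes are comparable
    with [path_codes n]. *)
Fixpoint pattern_paths B n : seq (seq nat) :=
  if n is n'.+1 then [seq x :: p | p <- pattern_paths B n', x <- path_starts B p]
  else [:: [::]].

Definition pattern_codes B n := map (code (pattern_arc B)) (pattern_paths B n).

Lemma pattern_pathsP B n p : p \in pattern_paths B n ->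
  [/\ size p = n, uniq p & all (gtn 6) p].
Proof.
elim: n p => [|n IHn] p /=; first by rewrite inE => /eqP->.
case/allpairsPdep=> q [x [/IHn[<- uq q6]]]; rewrite mem_filter => /andP[/andP[xq _]].
by rewrite mem_iota => x6 ->; split; rewrite /= ?xq ?uq ?q6 ?andbT.
Qed.

Lemma pattern_arcC B x y : x != y -> pattern_arc B y x = ~~ pattern_arc B x y.
Proof. by rewrite /pattern_arc; case: ltngtP => //= _ _; rewrite negbK. Qed.

Lemma pattern_arc_irr B : irreflexive (pattern_arc B).
Proof. by move=> x; rewrite /pattern_arc ltnn. Qed.

(** Reversing the arcs together with the order of the vertices keeps forward arcs forward. *)
Definition reverse_pattern B B' :=
  all (fun i => all (fun j => pattern_arc B' i j == pattern_arc B (5 - j) (5 - i)) (iota 0 6))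
    (iota 0 6).

Lemma EH_reverse_pattern B B' : reverse_pattern B B' ->
  EH [set: backward_tournament 6 B] -> EH [set: backward_tournament 6 B'].
Proof.
move=> /allP revB /EH_rev; apply: EH_embeds.
have iI (i : 'I_6) : (i : nat) \in iota 0 6 by rewrite mem_iota ltn_ord.
exists (fun i : 'I_6 => rev_ord i : rev_tournament (backward_tournament 6 B)) => [i j _ _|i _].
  by have /allP/(_ j (iI j))/eqP/esym := revB i (iI i); apply.
exact: in_setT.
Qed.

(** * Classification on at most six vertices *)

Definition base_patterns : seq (seq (nat * nat)) :=
  map fst galaxies ++
  [:: [:: (5, 1); (6, 1); (6, 3); (4, 2)]; [:: (4, 1); (6, 1); (6, 2)];
      [:: (6, 1); (5, 2); (4, 1)]; [:: (6, 2); (6, 1); (4, 1); (5, 3)];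
      [:: (6, 3); (6, 1); (5, 1)]].

(** The last three patterns are reversals of the fourth galaxy and of the tournaments of [EH_N1] and
    [EH_N3]. *)
Lemma EH_base : {in base_patterns, forall B, EH [set: backward_tournament 6 B]}.
Proof.
move=> B; rewrite mem_cat => /orP[/mapP[u ug ->]|].
  by apply: is_galaxy_EH (allP galaxies_ok u ug).
rewrite !inE => /or4P[/eqP->|/eqP->|/eqP->|/orP[/eqP->|/eqP->]].
- exact: EH_N1.
- exact: EH_N3.
- apply: (@EH_reverse_pattern [:: (6, 1); (5, 2); (6, 3)]); first by vm_compute.
  by apply: (@is_galaxy_EH _ [:: 2; 3; 4; 5; 6; 7]); vm_compute.
- by apply: EH_reverse_pattern EH_N1; vm_compute.
by apply: EH_reverse_pattern EH_N3; vm_compute.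
Qed.

Definition pattern_HD := [:: (4, 1); (6, 3); (5, 2); (6, 1)].

(** [H_D] is an exception for [n = 6] only, so the smaller tournaments left after removing a module
    are all covered. *)
Definition classified n :=
  let C := flatten [seq pattern_codes B n | B <- base_patterns] in
  let D := if n == 6 then pattern_codes pattern_HD n else [::] in
  all (fun R => [|| has_module n R, R \in C | R \in D]) (path_codes n).

Lemma classified_le6 : all classified (iota 0 7).
Proof. by vm_compute. Qed.

(** Both the module and the quotient are smaller than [U], since the module is proper and has at
    least two vertices. *)
Lemma EH_module (H : tournament) (U : {set H}) (s : seq H) :
    uniq s -> s =i U -> has_module (size s) (code (@arc H) s) ->
  (forall U' : {set H}, #|U'| < size s -> EH U') -> EH U.
Proof.
move=> us sU /hasP[m _ /and3P[]]; set I := mask m _ => I1 In /allP mod IH.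
have uI : uniq I by rewrite mask_uniq ?iota_uniq.
have Is i : i \in I -> i < size s by move/mem_mask; rewrite mem_iota.
have hI : head 0 I \in I by case: (I) I1 => // i I' _; rewrite mem_head.
have /hasP[x0 _ _] : has predT s by rewrite has_predT (leq_ltn_trans _ In).
pose nt := nth x0 s; pose W := [set x in map nt I].
have ntI : {in I &, injective nt} by move=> i j iI jI /uniqP; apply; rewrite ?inE ?Is.
have cardW : #|W| = size I by rewrite cardsE (card_uniqP _) ?size_map ?map_inj_in_uniq.
have ntW i : i \in I -> nt i \in W by move=> iI; rewrite inE map_f.
have WU : W \subset U.
  by apply/subsetP => x; rewrite inE => /mapP[i /Is is_ ->]; rewrite -sU mem_nth.
have cardU : #|U| = size s by rewrite -(card_uniqP us); apply: eq_card => x; rewrite sU.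
have hom : {in U :\: W & W, forall x w, arc x w = arc x (nt (head 0 I))}.
  move=> x w; rewrite !in_setD => /andP[nxW]; rewrite -sU => xs; rewrite inE => /mapP[j jI ->].
  have is_ : index x s < size s by rewrite index_mem.
  have xE : nt (index x s) = x by apply: nth_index.
  have : index x s \in iota 0 (size s) by rewrite mem_iota.
  move/mod/orP => [/ntW|/allP/(_ j jI)/eqP]; first by rewrite xE (negPf nxW).
  rewrite !(entry_code x0 (@arc_irr H) (@arcC H) us) ?is_ ?Is //.
  by rewrite -/(nt _) xE.
refine (EH_subst (ntW _ hI) hom _ _); apply: IH; first by rewrite cardW.
have := cardsID W U; rewrite (setIidPr WU) cardW cardU => <-.
by rewrite cardsU1 ltn_add2r (leq_ltn_trans (leq_b1 _) I1).
Qed.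

Lemma embeds_code (H : tournament) (U : {set H}) (s : seq H) B p :
    uniq s -> s =i U -> p \in pattern_paths B (size s) ->
    code (@arc H) s = code (pattern_arc B) p ->
  embeds U [set: backward_tournament 6 B].
Proof.
move=> us sU /pattern_pathsP[sp up /allP p6] eqc.
pose idx x := nth 0 p (index x s).
have idx6 x : x \in U -> idx x < 6.
  by rewrite -sU -index_mem -sp => xs; apply: p6; apply: mem_nth.
exists (fun x => inord (idx x) : 'I_6) => [x y xU yU|x _]; last exact: in_setT.
have [xs ys] : index x s < size s /\ index y s < size s by rewrite !index_mem !sU.
transitivity (pattern_arc B (idx x) (idx y)).
  by rewrite -[idx x in RHS](@inordK 5) ?idx6 // -[idx y in RHS](@inordK 5) ?idx6.
have := entry_code x (@arc_irr H) (@arcC H) us xs ys; rewrite !nth_index ?sU // => <-.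
by rewrite eqc (entry_code 0 (@pattern_arc_irr B) (@pattern_arcC B) up) ?sp.
Qed.

Lemma EH_small (H : tournament) (U : {set H}) : #|U| <= 6 ->
    (#|U| = 6 -> ~ embeds U [set: backward_tournament 6 pattern_HD]) -> EH U.
Proof.
have [n] := ubnP #|U|; elim: n U => // n IHn U ltUn U6 nHD.
have [s pUs ps] := hamiltonian_path (enum_uniq U).
have us : uniq s by rewrite -(perm_uniq pUs) enum_uniq.
have sU : s =i U by move=> x; rewrite -(perm_mem pUs) mem_enum.
have sE : size s = #|U| by rewrite -(perm_size pUs) -cardE.
have /(allP classified_le6)/allP : size s \in iota 0 7 by rewrite mem_iota sE.
move=> /(_ _ (mem_path_codes ps))/or3P[mod|/flattenP[_ /mapP[B Bb ->]]|].
- apply: (EH_module us sU mod) => U'; rewrite sE => ltU'; apply: IHn.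
  + exact: leq_trans ltU' ltUn.
  + by apply: leq_trans U6; apply: ltnW.
  + by move=> E; move: ltU'; rewrite E ltnNge U6.
- case/mapP=> p pB /(embeds_code us sU pB) UB.
  exact: EH_embeds UB (EH_base Bb).
case: eqP => // s6 /mapP[p pB /(embeds_code us sU pB) UB].
by case: nHD => //; rewrite -sE.
Qed.

(** * From the integer bound to the conjecture *)

Lemma embeds_contains (H T : tournament) : embeds [set: H] [set: T] -> contains T H.
Proof.
case=> f fm _; have {}fm x y : arc (f x) (f y) = arc x y by apply: fm; rewrite inE.
have fI : injective f.
  move=> x y fxy; apply/eqP; apply: contraT => /arc_total.
  by rewrite -!fm fxy addbb.
pose S := f @: [set: H]; exists S.
pose g (x : H) : induced S := exist _ (f x) (imset_f f (in_setT x)).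
have [h hK gK] : bijective g.
  apply: inj_card_bij; first by move=> x y /(congr1 val)/fI.
  by rewrite card_sig -[leqRHS]cardsT -(card_imset _ fI); apply/eq_leq/eq_card.
exists h; first by exists g.
by move=> u v; rewrite -[u in RHS]gK -[v in RHS]gK -fm.
Qed.

(** The index in [s] increases along every arc, so no cycle closes. *)
Lemma transitive_chain (T : tournament) (X : {set T}) s : chain X s ->
  transitive_tournament (induced [set x in s]).
Proof.
case/andP=> ps _ c; pose rk (u : induced [set x in s]) := index (val u) s.
have vs (u : induced [set x in s]) : val u \in s by have := valP u; rewrite inE.
have rk_lt u v : arc u v -> rk u < rk v.
  move=> uv; rewrite ltnNge; apply/negP; rewrite leq_eqVlt => /orP[/eqP/esym e|vu].
    have e' : val u = val v by rewrite -(nth_index (val u) (vs u)) -/(rk u) e nth_index.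
    by move: uv; rewrite /arc /= /induced_arc e' arc_irr.
  move/(pairwiseP (val u))/(_ (rk v) (rk u)): ps; rewrite !inE !index_mem !vs vu.
  by rewrite !nth_index // => /(_ isT isT isT)/arc_asym; rewrite [arc _ _]uv.
case: c => // u c /andP[cu _]; exfalso.
have srt : path ltn (rk u) (map rk (rcons c u)) by apply: (homo_path rk_lt).
by have := order_path_min ltn_trans srt; rewrite map_rcons all_rcons /= ltnn.
Qed.

Import Order.TTheory GRing.Theory Num.Theory.

Lemma EH_erdos_hajnal (R : realType) (H : tournament) :
  EH [set: H] -> erdos_hajnal R H.
Proof.
(* [a.+1] rather than [a] keeps the exponent positive when [a] is 0. *)
move=> [a Ea]; exists ((a.+1%:R : R)^-1)%R; first by rewrite invr_gt0 ltr0n.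
move=> T nTH; have leT : #|T| <= tr [set: T] ^ a.
  by rewrite -cardsT; apply: Ea => /embeds_contains.
have [s cs ss] := tr_chain [set: T]; exists [set x in s].
  exact: transitive_chain cs.
have cardS : #|[set x in s]| = size s by rewrite cardsE (card_uniqP (chain_uniq cs)).
have {}leT : #|T| <= size s ^ a.+1.
  have [T0|T0] := posnP #|T|; first by rewrite T0.
  apply: leq_trans leT _; rewrite ss leq_pexp2l //.
  by rewrite tr_gt0 cardsT.
rewrite cardS; apply: (@le_trans _ _ ((size s ^ a.+1)%:R `^ (a.+1%:R)^-1)%R).
  by apply: ge0_ler_powR; rewrite ?invr_ge0 ?ler0n ?nnegrE ?ler_nat.
rewrite natrX -powR_mulrn ?ler0n // -powRrM mulfV ?pnatr_eq0 //.
by rewrite powRr1 ?ler0n.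
Qed.

Theorem theorem18 (R : realType) (H : tournament) (card_H : #|H| = 6)
  (H_not_HD : ~ isomorphic H H_D) : erdos_hajnal R H.
Proof.
apply: EH_erdos_hajnal; apply: EH_small => [|_ [f fm _]]; first by rewrite cardsT card_H.
have {}fm x y : arc (f x) (f y) = arc x y by apply: fm; rewrite inE.
apply: H_not_HD; exists f => //; apply: inj_card_bij; last by rewrite card_ord card_H.
move=> x y fxy; apply/eqP; apply: contraT => /arc_total.
by rewrite -!fm fxy addbb.
Qed.
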